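(* Let $(X,\alpha)$ and $(Y,\beta)$ be Cantor minimal systems. The following are equivalent. (1) $K^0(X,\alpha)$ is unital order isomorphic to $K^0(Y,\beta)$. (2) $(X,\alpha)$ and $(Y,\beta)$ are strong orbit equivalent. (3) There is a homeomorphism $F:X\to Y$ such that $\overline{[[\alpha]]}=F^{-1}\,\overline{[[\beta]]}\,F$ (i.e. $\overline{[[\alpha]]}=\{F^{-1}\tau F:\tau\in\overline{[[\beta]]}\}$). (4) There exist homeomorphisms $\sigma_n\in[[\alpha]]$, $\tau_n\in[[\beta]]$ ($n\in\mathbb{N}$) and a homeomorphism $F:X\to Y$ such that $F\sigma_n\alpha\sigma_n^{-1}F^{-1}\to\beta$ in $\operatorname{Homeo}(Y)$ and $F^{-1}\tau_n\beta\tau_n^{-1}F\to\alpha$ in $\operatorname{Homeo}(X)$ as $n\to\infty$.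
   Context: A Cantor minimal system $(X,\alpha)$ consists of a Cantor set $X$ and a homeomorphism $\alpha$ of $X$ with no nontrivial closed invariant subsets. For a compact metrizable space $Z$, $\operatorname{Homeo}(Z)$ carries the topology of uniform convergence: $\gamma_n\to\gamma$ iff $\sup_{z\in Z}d(\gamma_n(z),\gamma(z))\to0$ for a compatible metric $d$ (equivalently $\sup_z|f(\gamma_n^{-1}(z))-f(\gamma^{-1}(z))|\to0$ for all $f\in C(Z)$); closures $\overline{\cdot}$ are taken in this topology. The coboundary subgroup is $B_\alpha=\{f-f\circ\alpha^{-1}: f\in C(X,\mathbb{Z})\}$ and $K^0(X,\alpha)=C(X,\mathbb{Z})/B_\alpha$, an ordered group with positive cone the classes of nonnegative functions and order unit $[1_X]$; a unital order isomorphism is a group isomorphism mapping positive cone onto positive cone and order unit to order unit. The full group $[\alpha]$ is the group of homeomorphisms $\gamma$ of $X$ with $\gamma(x)$ in the $\alpha$-orbit of $x$ for all $x$; its associated map $n:X\to\mathbb{Z}$ is given by $\gamma(x)=\alpha^{n(x)}(x)$. The topological full group $[[\alpha]]$ consists of those $\gamma\in[\alpha]$ whose associated map $n$ is continuous. $(X,\alpha)$ and $(Y,\beta)$ are strong orbit equivalent if there is a homeomorphism $F:X\to Y$ carrying $\alpha$-orbits onto $\beta$-orbits such that the functions $n:X\to\mathbb{Z}$, $m:Y\to\mathbb{Z}$ defined by $F(\alpha(x))=\beta^{n(x)}(F(x))$ and $F^{-1}(\beta(y))=\alpha^{m(y)}(F^{-1}(y))$ each have at most one point of discontinuity. *)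

(* Defs.v *)
From HB Require Import structures.
From mathcomp Require Import all_boot all_order all_algebra.
From mathcomp Require Import all_classical all_reals topology normedtype cantor.
Set Implicit Arguments. Unset Strict Implicit. Unset Printing Implicit Defensive.
Import Order.TTheory GRing.Theory Num.Theory.
Local Open Scope classical_set_scope.
Local Open Scope ring_scope.

Record homeo (X Y : topologicalType) := Homeo {
  hfun :> X -> Y;
  hinv : Y -> X;
  hfunK : cancel hfun hinv;
  hinvK : cancel hinv hfun;
  hfun_cont : continuous hfun;
  hinv_cont : continuous hinv }.

(** A Cantor set: nonempty, compact, Hausdorff, perfect, zero-dimensional
    (with metrizability provided by the pseudometric structure on the type). *)
Definition cantor_set (X : topologicalType) :=
  cantor_like X /\ [set: X] !=set0.

Definition iterz (X : topologicalType) (a : homeo X X) (k : int) : X -> X :=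
  match k with
  | Posz n => iter n (hfun a)
  | Negz n => iter n.+1 (hinv a)
  end.

Definition minimal (X : topologicalType) (a : homeo X X) :=
  forall A : set X, closed A -> hfun a @` A = A -> A = set0 \/ A = setT.

(** Continuity at a point / globally for Z-valued maps (Z discrete). *)
Definition int_cont_at (X : topologicalType) (f : X -> int) (x : X) :=
  \forall y \near x, f y = f x.
Definition Cint (X : topologicalType) : set (X -> int) :=
  [set f | forall x, int_cont_at f x].

Definition cobound (X : topologicalType) (a : homeo X X) : set (X -> int) :=
  [set h | exists2 f, Cint f & forall x, h x = f x - f (hinv a x)].

Definition K0pos (X : topologicalType) (a : homeo X X) (f : X -> int) :=
  exists p, [/\ Cint p, (forall x, 0 <= p x) & cobound a (fun x => f x - p x)].

(** Unital order isomorphism K^0(X,alpha) -> K^0(Y,beta), described through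
    a lift Phi : C(X,Z) -> C(Y,Z) of a map between the quotient groups. *)
Definition K0_unital_order_iso (X Y : topologicalType)
    (a : homeo X X) (b : homeo Y Y) :=
  exists Phi : (X -> int) -> (Y -> int),
  [/\
      (forall f, Cint f -> Cint (Phi f)) /\
      (* the induced map on quotients is well defined and injective *)
      (forall f, Cint f -> (cobound a f <-> cobound b (Phi f))),
      (forall f g, Cint f -> Cint g ->
        cobound b (fun y => Phi (fun x => f x + g x) y - Phi f y - Phi g y)),
      (forall g, Cint g -> exists2 f, Cint f & cobound b (fun y => Phi f y - g y)),
      (forall f, Cint f -> (K0pos a f <-> K0pos b (Phi f))) &
      cobound b (fun y => Phi (fun _ => 1) y - 1)].

Definition full_group (X : topologicalType) (a : homeo X X) (g : homeo X X) :=
  forall x, exists n : int, g x = iterz a n x.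
Definition top_full_group (X : topologicalType) (a : homeo X X) (g : homeo X X) :=
  exists2 n : X -> int, Cint n & forall x, g x = iterz a (n x) x.

Definition in_closure_tfg (R : realType) (X : pseudoMetricType R)
    (a : homeo X X) (g : homeo X X) :=
  forall e : R, 0 < e ->
    exists2 s, top_full_group a s & forall x, ball (g x) e (s x).

Definition unif_cvg (R : realType) (X : pseudoMetricType R)
    (gn : nat -> X -> X) (g : X -> X) :=
  forall e : R, 0 < e -> exists N, forall n, (N <= n)%N ->
    forall x, ball (g x) e (gn n x).

Definition strong_orbit_equiv (X Y : topologicalType)
    (a : homeo X X) (b : homeo Y Y) :=
  exists F : homeo X Y,
  [/\
      forall x x', (exists k, x' = iterz a k x) <-> (exists k, F x' = iterz b k (F x)) &
      exists (n : X -> int) (m : Y -> int),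
      [/\ forall x, F (a x) = iterz b (n x) (F x),
          forall y, hinv F (b y) = iterz a (m y) (hinv F y),
          exists x0, forall x, x <> x0 -> int_cont_at n x &
          exists y0, forall y, y <> y0 -> int_cont_at m y]].

(* Main.v *)
Require Import Defs.
From HB Require Import structures.
From mathcomp Require Import all_boot all_order all_algebra.
From mathcomp Require Import all_classical all_reals topology normedtype cantor.
From mathcomp Require Import zify.
Set Implicit Arguments. Unset Strict Implicit. Unset Printing Implicit Defensive.
Import Order.TTheory GRing.Theory Num.Theory.
Local Open Scope classical_set_scope.
Local Open Scope ring_scope.

(** All four conditions are compared with the existence of a homeomorphism
    [F : X -> Y] carrying the coboundaries of [a] onto those of [b] ([K0_lift]).

    From an isomorphism of [K^0], [F] is built by a back-and-forth over clopen
    partitions: a class between [0] and the class of a clopen set [W] is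
    realised by a clopen subset of [W], as one sees by counting along orbit
    segments between visits to a small clopen set. The same counting shows that
    the closure of the topological full group consists of the homeomorphisms
    acting trivially on [K^0], which settles condition (3).

    For strong orbit equivalence, cut the orbit of a base point [x0] between
    [a^-1 x0] and [x0]. The orbit segments between visits to shrinking
    neighbourhoods of [x0] form an increasing sequence of finite clopen
    equivalence relations, and a function is a coboundary iff its sums over the
    classes of one of these relations vanish. Two such sequences with the same
    coboundaries are intertwined by a sequence of small corrections of [F]
    (Krieger's argument), keeping [x0] and [a^-1 x0] fixed. The limit maps the
    cut orbits of [a] to those of [b], so its cocycle is continuous off
    [a^-1 x0]. Reordering each long [a]-segment as a concatenation of
    [b]-segments gives the approximate conjugacies of condition (4). *)

(** * Locally constant maps *)

(** The cut is forced by telescoping: a coboundary of [g] sums to zero over a segment as soon as [g]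
    composed with [a^-1] takes one value on the set of starting points, and for every locally
    constant [g] this holds once the starting points lie in a small cell around [x0]. In the limit
    only the step from [a^-1 x0] to [x0] is lost. The requirements [F x0 = y0] and
    [F (a^-1 x0) = b^-1 y0] put this step back, which is why two marked points are carried through
    the whole construction. A homeomorphism matching coboundaries need not match any of the finite
    relations, and a later correction could spoil an earlier match. Each correction therefore
    preserves a growing finite chain of matched pairs of relations exactly, while it moves points
    only within small cells; since the relations are closed, the matches survive in the limit. *)

Definition lc (X : topologicalType) (T : Type) (f : X -> T) :=
  forall x, \forall z \near x, f z = f x.

Section LocallyConstant.
Variables (X Y : topologicalType).

Lemma lc_cst T (t : T) : lc (fun _ : X => t).
Proof. by move=> x; near=> z. Unshelve. all: by end_near. Qed.

Lemma lc_comp T U (f : X -> T) (h : T -> U) : lc f -> lc (h \o f).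
Proof. by move=> lf x; near do rewrite /= (_ : f _ = f x) //; exact: lf.
Unshelve. all: by end_near. Qed.

Lemma lc_pair T U (f : X -> T) (g : X -> U) : lc f -> lc g ->
  lc (fun x => (f x, g x)).
Proof.
move=> lf lg x; near=> z; congr pair; near: z; [exact: lf|exact: lg].
Unshelve. all: by end_near. Qed.

Lemma lc_comp2 T U V (f : X -> T) (g : X -> U) (h : T -> U -> V) :
  lc f -> lc g -> lc (fun x => h (f x) (g x)).
Proof.
move=> lf lg; exact: (lc_comp (fun p => h p.1 p.2) (lc_pair lf lg)).
Qed.

Lemma lc_precomp T (f : Y -> T) (u : X -> Y) :
  continuous u -> lc f -> lc (f \o u).
Proof. by move=> cu lf x; have := cu x _ (lf (u x)). Qed.

Lemma lc_map I T (s : seq I) (f : I -> X -> T) :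
  (forall i, lc (f i)) -> lc (fun x => [seq f i x | i <- s]).
Proof.
move=> lf; elim: s => [|i s IH] /=; first exact: lc_cst.
exact: lc_comp2.
Qed.

Lemma lc_eqlocal T (f : X -> T) :
  (forall x : X, exists2 g : X -> T, lc g & \forall z \near x, f z = g z) -> lc f.
Proof.
move=> H x; have [g lg fg] := H x; have fx := nbhs_singleton fg.
near=> z; rewrite fx (near fg z)//; near: z; exact: lg.
Unshelve. all: by end_near. Qed.

Lemma continuous_local (u : X -> Y) :
  (forall x : X, exists2 v : X -> Y, continuous v & \forall z \near x, u z = v z) ->
  continuous u.
Proof.
move=> H x; have [v cv uv] := H x; have ux := nbhs_singleton uv.
move=> A; rewrite ux => /(cv x) vA.
by apply: filterS2 uv vA => z /= ->.
Qed.

End LocallyConstant.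

(** * Cantor spaces as spaces with a separating sequence of clopen bits *)

Record bits (X : topologicalType) := Bits {
  bit :> nat -> X -> bool;
  bits_compact : compact [set: X];
  bit_lc : forall k, lc (bit k);
  bits_sep : forall x y, (forall k, bit k x = bit k y) -> x = y;
  bits_perfect : forall (x : X) (A : set X), nbhs x A -> exists2 y, A y & y <> x }.

Fixpoint cell (X : topologicalType) (e : nat -> X -> bool) (k : nat) (x : X) : nat :=
  if k is k'.+1 then ((cell e k' x).*2 + e k' x)%N else 0%N.

Section Bits.
Variables (X : topologicalType) (e : bits X).
Notation c := (cell e).

Lemma cell_lc k : lc (c k).
Proof.
elim: k => [|k IH]; first exact: lc_cst.
exact: (lc_comp2 (fun a (b : bool) => (a.*2 + b)%N) IH (bit_lc e k)).
Qed.

Lemma half_double_bit (n : nat) (b : bool) : (n.*2 + b)./2 = n.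
Proof. by case: b; rewrite ?addn1 /= ?uphalf_double ?addn0 ?doubleK. Qed.

Lemma odd_double_bit (n : nat) (b : bool) : odd (n.*2 + b) = b.
Proof. by rewrite oddD odd_double; case: b. Qed.

Lemma cellW k l x y : (k <= l)%N -> c l x = c l y -> c k x = c k y.
Proof.
move=> /subnK <-; elim: (l - k)%N => [//|n IH] /= H; apply: IH.
by rewrite -(half_double_bit (c (n + k) x) (e (n + k) x)) H half_double_bit.
Qed.

Lemma cell_bit k x y : c k.+1 x = c k.+1 y -> e k x = e k y.
Proof. by move=> /= /(congr1 odd); rewrite !odd_double_bit. Qed.

Lemma cell_sep x y : (forall k, c k x = c k y) -> x = y.
Proof. by move=> H; apply: (bits_sep (b := e)) => k; apply/cell_bit/H. Qed.

(** Compactness enters the later arguments in this form: monotonicity lets finitely many local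
    thresholds be replaced by one. *)
Lemma compact_uniform (P : nat -> X -> Prop) :
  (forall k l x, (k <= l)%N -> P k x -> P l x) ->
  (forall x : X, exists k, \forall z \near x, P k z) ->
  exists k, forall x, P k x.
Proof.
move=> Pmono Ploc.
have /compact_near_coveringP cov := bits_compact e.
have [] := cov nat \oo P _ _.
  move=> x _; have [k Pk] := Ploc x.
  exists ([set z | P k z], [set l | (k <= l)%N]).
    by split => //; exists k.
  by move=> [z l] /= [Pz kl]; exact: Pmono kl Pz.
by move=> N _ HN; exists N => x; apply: (HN N (leqnn N)).
Qed.

(** Any other point is told from [x] by some [Q k] on a whole neighbourhood, and compactness makes
    the level uniform; so a nested separating sequence generates the topology. *)
Lemma sep_nbhs (Q : nat -> X -> nat) x (A : set X) :
  (forall k, lc (Q k)) -> (forall k y z, Q k.+1 y = Q k.+1 z -> Q k y = Q k z) ->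
  (forall y z, (forall k, Q k y = Q k z) -> y = z) ->
  nbhs x A -> exists k, forall z, Q k z = Q k x -> A z.
Proof.
move=> lQ nestQ sepQ Ax.
have QW k l y z : (k <= l)%N -> Q l y = Q l z -> Q k y = Q k z.
  by move=> /subnK <-; elim: (l - k)%N => [//|n IH] /= /nestQ.
have [||k Hk] := @compact_uniform (fun k z => Q k z = Q k x -> A z).
- by move=> k l z kl H /(QW _ _ _ _ kl).
- move=> z; have [->|zx] := pselect (z = x).
    by exists 0%N; near do move=> _.
  have [k ck] : exists k, Q k z <> Q k x.
    by apply: contrapT => /forallNP H; apply/zx/sepQ => k; apply: contrapT.
  exists k; have := lQ k z.
  by apply: filterS => w -> /ck.
- by exists k.
Unshelve. all: by end_near. Qed.

Lemma cell_nbhs x (A : set X) : nbhs x A ->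
  exists k, forall z, c k z = c k x -> A z.
Proof.
apply: sep_nbhs; [exact: cell_lc|move=> k y z; exact: cellW|exact: cell_sep].
Qed.

Lemma lc_cell T (f : X -> T) : lc f ->
  exists k, forall x y, c k x = c k y -> f x = f y.
Proof.
move=> lf.
have [||k Hk] := @compact_uniform (fun k x => forall y, c k y = c k x -> f y = f x).
- by move=> k l x kl H y /(cellW kl); apply: H.
- move=> x; have [k Hk] := cell_nbhs (lf x).
  exists k; have := cell_lc k x; apply: filterS => z cz y cy.
  by rewrite (Hk y) ?cy// (Hk z).
- by exists k => x y; apply: Hk.
Qed.

Lemma lc_bounded (f : X -> nat) : lc f -> exists N, forall x, (f x < N)%N.
Proof.
move=> lf; apply: (@compact_uniform (fun N x => (f x < N)%N)).
- by move=> k l x kl /leq_trans; apply.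
- by move=> x; exists (f x).+1; have := lf x; apply: filterS => z ->.
Qed.

Lemma bits_closed_nested (A : nat -> set X) :
  (forall k (x : X), ~ A k x -> \forall z \near x, ~ A k z) ->
  (forall k l x, (k <= l)%N -> A l x -> A k x) ->
  (forall k, exists x, A k x) -> exists x, forall k, A k x.
Proof.
move=> Acl Amono Ane; apply: contrapT => /forallNP H.
have [||k Hk] := @compact_uniform (fun k x => ~ A k x).
- by move=> k l x kl + Al; apply; exact: Amono Al.
- by move=> x; have /existsNP [k nk] := H x; exists k; exact: Acl.
- by have [x Ax] := Ane k; apply: Hk Ax.
Qed.

End Bits.

(** The bits enumerate all clopen sets, which separate points by zero-dimensionality. *)
Lemma cantor_bits (R : realType) (X : pseudoMetricType R) :
  cantor_set X -> exists _ : bits X, True.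
Proof.
move=> [[perf cpt _ zd] [x0 _]].
pose PX : pseudoPMetricType R := HB.pack (X : Type) X (isPointed.Build X x0).
have [f] := @clopen_surj R PX cpt.
pose b k (x : X) := `[< f k x >].
have bU k : @clopen X (f k) by apply: (@funS _ _ _ _ f k).
unshelve eexists => //; apply: (@Bits X b) => //.
- move=> k x; have [oU cU] := bU k; have [fx|nfx] := pselect (f k x).
    have : nbhs x (f k) by apply: open_nbhs_nbhs.
    by apply: filterS => z fz; rewrite /b !asboolT.
  have : nbhs x (~` f k) by apply: open_nbhs_nbhs; split => //; exact: closed_openC.
  by apply: filterS => z fz; rewrite /b !asboolF.
- move=> x y H; apply: contrapT => /eqP xy.
  have [U [cU Ux nUy]] := zd _ _ xy.
  have [k _ Uk] := @surj _ _ _ _ f U cU.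
  by have := H k; rewrite /b Uk (asboolT Ux) (asboolF nUy).
- move=> x A; rewrite nbhsE => -[B [oB Bx] BA].
  have [y [z [By Bz yz]]] := (iffLR perfectTP_ex) perf B oB (ex_intro _ x Bx).
  have [yx|] := eqVneq y x; last by exists y; [exact: BA|exact/eqP].
  by exists z; [exact: BA|apply/eqP; rewrite -yx eq_sym].
Qed.

(** * Homeomorphisms *)

Definition hid (X : topologicalType) : homeo X X :=
  @Homeo X X id id (fun x => erefl) (fun x => erefl)
    (fun x => cvg_id) (fun x => cvg_id).

Definition hsym (X Y : topologicalType) (F : homeo X Y) : homeo Y X :=
  Homeo (hinvK F) (hfunK F) (@hinv_cont _ _ F) (@hfun_cont _ _ F).

Lemma continuous_compose (X Y Z : topologicalType) (f : X -> Y) (g : Y -> Z) :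
  continuous f -> continuous g -> continuous (g \o f).
Proof. by move=> cf cg x; apply: continuous_comp; [exact: cf|exact: cg]. Qed.

Definition hcomp (X Y Z : topologicalType) (G : homeo Y Z) (F : homeo X Y) :
    homeo X Z :=
  @Homeo X Z (G \o F) (hinv F \o hinv G)
    (can_comp (hfunK G) (hfunK F)) (can_comp (hinvK F) (hinvK G))
    (continuous_compose (@hfun_cont _ _ F) (@hfun_cont _ _ G))
    (continuous_compose (@hinv_cont _ _ G) (@hinv_cont _ _ F)).

(** [F x] is the common point of the nested nonempty closed sets where [Q k] takes the value
    [P k x]; the symmetric construction gives the inverse. *)
Lemma limit_homeo (X Y : topologicalType) (eX : bits X) (eY : bits Y)
    (P : nat -> X -> nat) (Q : nat -> Y -> nat) :
  (forall k, lc (P k)) -> (forall k, lc (Q k)) ->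
  (forall x x', (forall k, P k x = P k x') -> x = x') ->
  (forall y y', (forall k, Q k y = Q k y') -> y = y') ->
  (forall k x, exists y, Q k y = P k x) ->
  (forall k y, exists x, P k x = Q k y) ->
  (forall k x y, P k.+1 x = Q k.+1 y -> P k x = Q k y) ->
  exists F : homeo X Y, forall k x, Q k (F x) = P k x.
Proof.
have half (X' Y' : topologicalType) (e : bits X') (e' : bits Y')
    (P' : nat -> X' -> nat) (Q' : nat -> Y' -> nat) :
    (forall k, lc (P' k)) -> (forall k, lc (Q' k)) ->
    (forall y y', (forall k, Q' k y = Q' k y') -> y = y') ->
    (forall k x, exists y, Q' k y = P' k x) ->
    (forall k y, exists x, P' k x = Q' k y) ->
    (forall k x y, P' k.+1 x = Q' k.+1 y -> P' k x = Q' k y) ->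
    exists2 f : X' -> Y', continuous f & forall k x, Q' k (f x) = P' k x.
  move=> lP lQ sepQ PQ QP nest.
  have nestQ k y y' : Q' k.+1 y = Q' k.+1 y' -> Q' k y = Q' k y'.
    have [x Px] := QP k.+1 y => Qyy.
    by rewrite -(nest k x y)// -(nest k x y')// -Qyy.
  have ex x : exists y, forall k, Q' k y = P' k x.
    apply: (bits_closed_nested e' (A := fun k y => Q' k y = P' k x)) => //.
    - by move=> k y nQ; have := lQ k y; apply: filterS => z ->.
    - move=> k l y /subnK <-; elim: (l - k)%N => [//|n IH] H; apply: IH.
      by apply/esym/nest.
  have [f Hf] := choice ex; exists f => // x A nA.
  have [k Hk] := sep_nbhs e' lQ nestQ sepQ nA.
  have := lP k x; apply: filterS => z Pz; apply: Hk.
  by rewrite !Hf.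
move=> lP lQ sepP sepQ PQ QP nest.
have [f cf Hf] := half _ _ eX eY P Q lP lQ sepQ PQ QP nest.
have [//|g cg Hg] := half _ _ eY eX Q P lQ lP sepP QP PQ.
  by move=> k x y /esym/nest.
have fK : cancel f g by move=> x; apply: sepP => k; rewrite Hg Hf.
have gK : cancel g f by move=> x; apply: sepQ => k; rewrite Hf Hg.
by exists (Homeo fK gK cf cg).
Qed.

(** * Comparison of the uniform structure with cells *)

Section Metric.
Variables (R : realType) (X : pseudoMetricType R) (e : bits X).

Lemma cell_ball (r : R) : 0 < r ->
  exists k, forall x y, cell e k x = cell e k y -> ball x r y.
Proof.
move=> r0.
have [||k Hk] := @compact_uniform _ e
    (fun k x => forall y, cell e k x = cell e k y -> ball x r y).
- by move=> k l x kl H y /(cellW kl); apply: H.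
- move=> x; have [|k Hk] := @cell_nbhs _ e x (ball x (r / 2)).
    by apply: nbhsx_ballx; rewrite divr_gt0.
  exists k; have := cell_lc e k x; apply: filterS => z cz y cy.
  rewrite [r]splitr; apply: (@ball_triangle _ _ x).
    by apply/ball_sym/Hk.
  by apply: Hk; rewrite -cy cz.
- by exists k.
Qed.

Lemma ball_cell k : exists2 r : R, 0 < r &
  forall x y, ball x r y -> cell e k x = cell e k y.
Proof.
have [||n Hn] := @compact_uniform _ e
    (fun n x => forall y, ball x (n.+1%:R^-1 : R) y -> cell e k x = cell e k y).
- move=> m n x mn H y xy; apply: H; apply: le_ball xy.
  by rewrite lef_pV2 ?posrE ?ltr0Sn// ler_nat.
- move=> x.
  have /nbhs_ballP [d /= d0 Hd] := cell_lc e k x.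
  have d20 : 0 < d / 2 by rewrite divr_gt0.
  have [n] := @ltr_add_invr R 0 (d / 2) d20; rewrite add0r => nd.
  exists n; have : nbhs x (ball x (d / 2)) by apply: nbhsx_ballx.
  apply: filterS => z xz y zy.
  have xd : ball x d z by apply: le_ball xz; rewrite [leRHS]splitr lerDl ltW.
  rewrite (Hd z)// (Hd y)//; rewrite [d]splitr; apply: (@ball_triangle _ _ z) => //.
  by apply: le_ball zy; exact: ltW.
- by exists n.+1%:R^-1 => //; rewrite invr_gt0.
Qed.

End Metric.

(** * Finite clopen equivalence relations *)

(* A relation is given by its classes, listed in an order that depends only on
   the class; locally the listing consists of continuous functions of the point. *)
Record fcr (X : topologicalType) := Fcr {
  cls :> X -> seq X;
  cls_self : forall x, x \in cls x;
  cls_eq : forall x y, y \in cls x -> cls y = cls x;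
  cls_uniq : forall x, uniq (cls x);
  cls_loc : forall x : X, exists n (g : nat -> X -> X),
    (forall i, continuous (g i)) /\
    \forall z \near x, cls z = [seq g i z | i <- iota 0 n] }.

Lemma index_map_uniq (S T : eqType) (f : S -> T) (s : seq S) x :
  uniq (map f s) -> x \in s -> index (f x) (map f s) = index x s.
Proof.
elim: s => [//|y s IH] /= /andP[ny us]; rewrite inE => /orP[/eqP ->|xs].
  by rewrite !eqxx.
rewrite IH//; case: eqP => [fyx|nfyx].
  by case/negP: ny; rewrite fyx; apply: map_f.
by case: eqP => // yx; case: nfyx; rewrite yx.
Qed.

Lemma sep_seq (X : topologicalType) (e : bits X) (s : seq X) :
  uniq s -> exists k, uniq (map (cell e k) s).
Proof.
elim: s => [|x s IH] /=; first by exists 0%N.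
move=> /andP[nx /IH [k uk]].
have [l Hl] : exists l, forall y, y \in s -> cell e l x <> cell e l y.
  elim: s nx {IH uk} => [|y s IH]; first by exists 0%N.
  rewrite inE negb_or => /andP[xy /IH [l Hl]].
  have [m Hm] : exists m, cell e m x <> cell e m y.
    apply: contrapT => /forallNP H; move/eqP: xy; apply; apply: (cell_sep (e := e)) => m.
    exact: contrapT.
  exists (maxn l m) => z; rewrite inE => /orP[/eqP -> E|/Hl H E].
    by apply: Hm; apply: cellW E; rewrite leq_maxr.
  by apply: H; apply: cellW E; rewrite leq_maxl.
exists (maxn k l); apply/andP; split.
  apply/mapP => -[y ys E]; apply: (Hl y ys).
  by apply: cellW E; rewrite leq_maxr.
rewrite map_inj_in_uniq ?(map_uniq uk)// => y z ys zs E.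
have {}E : cell e k y = cell e k z by apply: cellW E; rewrite leq_maxl.
by rewrite -(nth_index y ys) -(index_map_uniq uk ys) E (index_map_uniq uk zs) nth_index.
Qed.

Section Fcr.
Variables (X : topologicalType) (e : bits X) (T : fcr X).

Lemma cls_sym x y : y \in T x -> x \in T y.
Proof. by move=> /cls_eq ->; exact: cls_self. Qed.

Lemma cls_trans x y z : y \in T x -> z \in T y -> z \in T x.
Proof. by move=> /cls_eq ->. Qed.

Lemma lc_cls_map U (f : X -> U) : lc f -> lc (fun x => map f (T x)).
Proof.
move=> lf; apply: lc_eqlocal => x; have [n [g [cg Hg]]] := cls_loc T x.
exists (fun z => [seq f (g i z) | i <- iota 0 n]).
  by apply: lc_map => i; exact: lc_precomp (cg i) lf.
by apply: filterS Hg => z ->; rewrite -map_comp.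
Qed.

(** Holonomy to the [j]-th point of the class. The default [x] keeps it inside the class and
    continuous for every [j]. *)
Definition hol (j : nat) (x : X) := nth x (T x) j.
Definition pos (x : X) := index x (T x).

Lemma hol_continuous j : continuous (hol j).
Proof.
apply: continuous_local => x; have [n [g [cg Hg]]] := cls_loc T x.
have [jn|nj] := ltnP j n.
- exists (g j) => //; apply: filterS Hg => z Hz.
  by rewrite /hol Hz (nth_map 0%N) ?size_iota// nth_iota.
- exists id; first by move=> ?; exact: cvg_id.
  by apply: filterS Hg => z Hz; rewrite /hol Hz nth_default// size_map size_iota.
Qed.

Lemma pos_lt x : (pos x < size (T x))%N.
Proof. by rewrite index_mem cls_self. Qed.

Lemma hol_pos x : hol (pos x) x = x.
Proof. by rewrite /hol nth_index// cls_self. Qed.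

Lemma hol_in j x : hol j x \in T x.
Proof.
have [js|sj] := ltnP j (size (T x)); first exact: mem_nth.
by rewrite /hol nth_default// cls_self.
Qed.

Lemma pos_hol j x : (j < size (T x))%N -> pos (hol j x) = j.
Proof. by move=> js; rewrite /pos (cls_eq (hol_in j x)) index_uniq// cls_uniq. Qed.

Lemma hol_hol i j x : (j < size (T x))%N -> hol j (hol i x) = hol j x.
Proof. by move=> js; rewrite {1}/hol (cls_eq (hol_in i x)); exact: set_nth_default. Qed.

Lemma hol_eq j x y : (j < size (T x))%N -> y \in T x -> hol j y = hol j x.
Proof. by move=> js yx; rewrite /hol (cls_eq yx); exact: set_nth_default. Qed.

Lemma pos_inj x y : y \in T x -> pos y = pos x -> y = x.
Proof.
move=> yx pyx; rewrite -(hol_pos y) pyx (hol_eq _ yx) ?hol_pos//.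
exact: pos_lt.
Qed.

Lemma pos_lc : lc pos.
Proof.
(* The points of a class vary continuously without being locally constant, so the index is computed
   on cell codes, at a level that separates the class. *)
apply: lc_eqlocal => x; have [k uk] := sep_seq e (cls_uniq T x).
have lm := lc_cls_map (cell_lc e k).
exists (fun z => index (cell e k z) (map (cell e k) (T z))).
  exact: (lc_comp2 (fun a b => index a b) (cell_lc e k) lm).
have := lm x; apply: filterS => z Hz.
by rewrite /pos index_map_uniq ?cls_self// Hz.
Qed.

Lemma hol_lc_continuous (j : X -> nat) : lc j -> continuous (fun x => hol (j x) x).
Proof.
move=> lj; apply: continuous_local => x; exists (hol (j x)); first exact: hol_continuous.
by have := lj x; apply: filterS => z ->.
Qed.

Definition csum (f : X -> int) (x : X) := \sum_(y <- T x) f y.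
Definition null (f : X -> int) := forall x, csum f x = 0.

Lemma csum_lc f : lc f -> lc (csum f).
Proof.
move=> lf; have := lc_comp (fun s : seq int => \sum_(v <- s) v) (lc_cls_map lf).
by move=> H x; have := H x; apply: filterS => z /=; rewrite !big_map.
Qed.

Lemma csum_cls f x y : y \in T x -> csum f y = csum f x.
Proof. by move=> yx; rewrite /csum (cls_eq yx). Qed.

Lemma sum_indic (p : pred X) (s : seq X) :
  \sum_(y <- s) (p y)%:R = (count p s)%:R :> int.
Proof.
elim: s => [|y s IH]; first by rewrite big_nil.
by rewrite big_cons IH /= natrD.
Qed.

(** Every class carries each colour equally often under [P] and [Q]. The permutation is chosen from
    the two colour lists alone, so it is common to all points of a class and locally constant, which
    makes [s] continuous. *)
Lemma fcr_match (P Q : X -> nat) : lc P -> lc Q ->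
  (forall i, null (fun y => (P y == i)%:R - (Q y == i)%:R)) ->
  exists s : homeo X X, forall x, s x \in T x /\ Q (s x) = P x.
Proof.
move=> lP lQ nPQ.
have /choice [Is HIs] : forall pq : seq nat * seq nat, exists Is : seq nat,
    perm_eq pq.1 pq.2 -> perm_eq Is (iota 0 (size pq.2)) /\
      pq.1 = map (nth 0%N pq.2) Is.
  move=> [p q] /=; have [/(perm_iotaP 0%N) [Is H1 H2]|npq] := boolP (perm_eq p q).
    by exists Is.
  by exists [::].
pose I x := Is (map P (T x), map Q (T x)).
have PQperm x : perm_eq (map P (T x)) (map Q (T x)).
  apply/allP => i _ /=; rewrite !count_map.
  have := nPQ i x; rewrite /csum sumrB !sum_indic => /subr0_eq/eqP.
  by rewrite eqr_nat.
have Iperm x : perm_eq (I x) (iota 0 (size (T x))).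
  by have [+ _] := HIs (map P (T x), map Q (T x)) (PQperm x); rewrite size_map.
have IP x : map P (T x) = map (nth 0%N (map Q (T x))) (I x).
  by have [_ +] := HIs (map P (T x), map Q (T x)) (PQperm x).
have Isz x : size (I x) = size (T x) by rewrite (perm_size (Iperm x)) size_iota.
have Iu x : uniq (I x) by rewrite (perm_uniq (Iperm x)) iota_uniq.
have Imem x i : (i \in I x) = (i < size (T x))%N.
  by rewrite (perm_mem (Iperm x)) mem_iota.
have lI : lc I.
  exact: (lc_comp2 (fun p q => Is (p, q)) (lc_cls_map lP) (lc_cls_map lQ)).
have Icls x y : y \in T x -> I y = I x by move=> yx; rewrite /I (cls_eq yx).
pose s x := hol (nth 0%N (I x) (pos x)) x.
pose s' x := hol (index (pos x) (I x)) x.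
have cs : continuous s.
  apply: (hol_lc_continuous (j := fun x => nth 0%N (I x) (pos x))).
  exact: (lc_comp2 (fun a b => nth 0%N a b) lI pos_lc).
have cs' : continuous s'.
  apply: (hol_lc_continuous (j := fun x => index (pos x) (I x))).
  exact: (lc_comp2 (fun a b => index a b) pos_lc lI).
have nlt x : (nth 0%N (I x) (pos x) < size (T x))%N.
  by rewrite -Imem mem_nth// Isz pos_lt.
have ilt x : (index (pos x) (I x) < size (T x))%N.
  by rewrite -Isz index_mem Imem pos_lt.
have sK : cancel s s'.
  move=> x; rewrite /s' /s (Icls x) ?hol_in// pos_hol// index_uniq ?Isz ?pos_lt//.
  by rewrite hol_hol ?hol_pos ?pos_lt.
have s'K : cancel s' s.
  move=> x; rewrite /s' /s (Icls x) ?hol_in// pos_hol// nth_index ?Imem ?pos_lt//.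
  by rewrite hol_hol ?hol_pos ?pos_lt.
exists (Homeo sK s'K cs cs') => x /=; split; first exact: hol_in.
have := congr1 (fun l => nth 0%N l (pos x)) (IP x).
rewrite (nth_map x) ?pos_lt// -/(hol _ _) hol_pos => ->.
rewrite (nth_map 0%N) ?Isz ?pos_lt//.
by rewrite (nth_map x) ?nlt.
Qed.

End Fcr.

Section FcrSub.
Variables (X : topologicalType).

Definition subfcr (Q T : fcr X) := forall x y, y \in Q x -> y \in T x.

(** A [T]-class is a disjoint union of [Q]-classes; the induction removes one of them at a time from
    a saturated list. *)
Lemma null_mono (Q T : fcr X) f : subfcr Q T -> null Q f -> null T f.
Proof.
move=> QT nQ x.
have : forall s : seq X, uniq s -> (forall y z, y \in s -> z \in Q y -> z \in s) ->
    \sum_(y <- s) f y = 0.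
  move=> s; have [n] := ubnP (size s); elim: n s => [//|n IH] [|y s] sn us sat.
    by rewrite big_nil.
  rewrite (bigID (fun z => z \in Q y)) /=.
  have -> : \sum_(i <- y :: s | i \in Q y) f i = csum Q f y.
    rewrite -big_filter; apply: perm_big; apply: uniq_perm.
    - exact: filter_uniq.
    - exact: cls_uniq.
    - move=> z; rewrite mem_filter; case zQ: (z \in Q y) => //=.
      by apply: sat zQ; rewrite inE eqxx.
  rewrite nQ add0r -big_filter; apply: IH.
  - rewrite /= cls_self /= size_filter.
    by apply: leq_ltn_trans (count_size _ _) _.
  - exact: filter_uniq.
  - move=> z w; rewrite !mem_filter => /andP[zy zs] wz; rewrite (sat z w)// andbT.
    apply: contra zy => wy; apply: cls_trans wy _; exact: cls_sym.
apply; first exact: cls_uniq.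
move=> y z yx zy; apply: cls_trans yx _; exact: QT.
Qed.

Lemma nullB (T : fcr X) f g : null T f -> null T g -> null T (fun x => f x - g x).
Proof. by move=> nf ng x; rewrite /csum sumrB -/(csum T f x) -/(csum T g x) nf ng subrr. Qed.

Lemma nullD (T : fcr X) f g : null T f -> null T g -> null T (fun x => f x + g x).
Proof. by move=> nf ng x; rewrite /csum big_split /= -/(csum T f x) -/(csum T g x) nf ng addr0. Qed.

(** Within each class [u] is a bijection from the points of [A] to those of [B], so both sums have
    the same terms. *)
Lemma null_move (T : fcr X) (A B : pred X) (u : X -> X) (f : X -> int) :
  (forall x, A x -> u x \in T x /\ B (u x)) ->
  (forall x y, A x -> A y -> u x = u y -> x = y) ->
  (forall y, B y -> exists2 x, A x & u x = y) ->
  null T (fun x => (if A x then f (u x) else 0) - (if B x then f x else 0)).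
Proof.
move=> uT uinj usurj x; rewrite /csum sumrB -!big_mkcond /= -[in LHS]big_filter.
rewrite -(big_map u predT) -[X in _ - X]big_filter; apply/eqP; rewrite subr_eq0.
apply/eqP; apply: perm_big; apply: uniq_perm.
- rewrite map_inj_in_uniq ?filter_uniq ?cls_uniq// => y z.
  by rewrite !mem_filter => /andP[Ay _] /andP[Az _]; exact: uinj.
- by rewrite filter_uniq ?cls_uniq.
- move=> y; rewrite mem_filter; apply/mapP/andP => [[z]|[By yx]].
    rewrite mem_filter => /andP[Az zx] ->; have [uz Bz] := uT z Az.
    by split => //; exact: cls_trans zx uz.
  have [z Az uz] := usurj y By; exists z => //; rewrite mem_filter Az /=.
  by apply: cls_trans yx _; apply: cls_sym; rewrite -uz; have [] := uT z Az.
Qed.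

End FcrSub.

Section Pull.
Variables (X Y : topologicalType) (F : homeo X Y) (S : fcr Y).

Definition pull_cls (x : X) := map (hinv F) (S (F x)).

Lemma mem_pull_cls x y : (y \in pull_cls x) = (F y \in S (F x)).
Proof.
by rewrite -{1}(hfunK F y) mem_map//; exact: can_inj (hinvK F).
Qed.

Lemma pull_subproof (x : X) : exists n (g : nat -> X -> X),
    (forall i, continuous (g i)) /\
    \forall z \near x, pull_cls z = [seq g i z | i <- iota 0 n].
Proof.
have [n [g [cg Hg]]] := cls_loc S (F x).
exists n, (fun i => hinv F \o (g i \o F)); split.
  move=> i; apply: continuous_compose; last exact: hinv_cont.
  by apply: continuous_compose => //; exact: hfun_cont.
have : nbhs x (F @^-1` [set y | S y = [seq g i y | i <- iota 0 n]]).
  exact: (@hfun_cont _ _ F x _ Hg).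
by apply: filterS => z /= Hz; rewrite /pull_cls Hz -map_comp.
Qed.

Definition fcr_pull : fcr X.
Proof.
refine (@Fcr X pull_cls _ _ _ pull_subproof).
- by move=> x; rewrite mem_pull_cls cls_self.
- by move=> x y; rewrite mem_pull_cls => /cls_eq; rewrite /pull_cls => ->.
- by move=> x; rewrite map_inj_uniq ?cls_uniq//; exact: can_inj (hinvK F).
Defined.

Lemma mem_pull x y : (y \in fcr_pull x) = (F y \in S (F x)).
Proof. exact: mem_pull_cls. Qed.

Lemma null_pull f : null fcr_pull f -> null S (f \o hinv F).
Proof.
move=> nf y; have := nf (hinv F y).
by rewrite /csum /= /pull_cls hinvK big_map.
Qed.

End Pull.

Lemma fcr_match_set (X : topologicalType) (e : bits X) (T : fcr X) (A B : pred X) :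
  lc A -> lc B -> null T (fun y => (A y)%:R - (B y)%:R) ->
  exists s : homeo X X, forall x, s x \in T x /\ B (s x) = A x.
Proof.
move=> lA lB nAB.
have [||i|s Hs] := @fcr_match X e T (fun x => A x : nat) (fun x => B x : nat).
- exact: (lc_comp nat_of_bool lA).
- exact: (lc_comp nat_of_bool lB).
- move=> x; case: i => [|[|i]].
  + rewrite -[RHS]oppr0 -[X in - X](nAB x) /csum -sumrN; apply: eq_bigr => y _.
    by case: (A y); case: (B y).
  + by rewrite -[RHS](nAB x); apply: eq_bigr => y _; case: (A y); case: (B y).
  + by rewrite /csum big1// => y _; case: (A y); case: (B y).
by exists s => x; have [? H] := Hs x; split => //; move: H; case: (A x); case: (B _).
Qed.

Lemma null_colours (X : topologicalType) (U : eqType) (T : fcr X) (K : X -> U)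
    (g : X -> int) :
  (forall x, null T (fun y => if K y == K x then g y else 0)) -> null T g.
Proof.
move=> nK x; rewrite /csum.
have : forall v, \sum_(y <- T x | K y == v) g y = 0.
  move=> v; have [/hasP [y _ /eqP Ky]|/hasPn nh] := boolP (has (fun y => K y == v) (T x)).
    by rewrite big_mkcond -Ky; exact: nK.
  by rewrite big_seq_cond big1// => y /andP[/nh /negbTE ->].
move: (T x) => s; have [n] := ubnP (size s); elim: n s => [//|n IH] [|y s] sn Hs.
  by rewrite big_nil.
rewrite (bigID (fun z => K z == K y)) /= Hs add0r -big_filter; apply: IH.
  by rewrite /= eqxx /= size_filter; apply: leq_ltn_trans (count_size _ _) _.
move=> v; rewrite big_filter_cond; have [->|vy] := eqVneq v (K y).
  by rewrite big1// => z /andP[/negbTE ->].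
rewrite -[RHS](Hs v); apply: eq_bigl => z; have [->|] := eqVneq (K z) v; last by rewrite andbF.
by rewrite vy.
Qed.

(** * One correction step of the intertwining *)

Section Step.
Variables (X : topologicalType) (e : bits X) (R : nat -> fcr X) (S T : fcr X).
Variables (Qs : seq (fcr X)) (n0 : nat) (x0 x1 : X) (c : X -> nat).
Hypothesis R_mono : forall n, subfcr (R n) (R n.+1).
Hypothesis S_null : forall f : X -> int, lc f -> null S f -> exists p, null (R p) f.
Hypothesis TS : subfcr T S.
Hypothesis TR : subfcr T (R n0).
Hypothesis QsT : forall j, subfcr (nth T Qs j) T.
Hypothesis x01 : x1 \notin S x0.
Hypothesis c_lc : lc c.

Lemma fcr_monoW p q : (p <= q)%N -> subfcr (R p) (R q).
Proof.
move=> /subnK <-; elim: (q - p)%N => [//|n IH] x y /IH; exact: R_mono.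
Qed.

Local Notation ps := (pos S).
Local Notation h := (hol S).
Local Notation QQ j := (nth T (T :: Qs) j).

(** Where the class of [y], for [T] and for each relation of [Qs], sits inside its [S]-class. A
    correction preserving these positions keeps the earlier relations intact. *)
Definition patterns (y : X) : seq (seq nat) := [seq map ps (Q y) | Q : fcr X <- T :: Qs].

Lemma patterns_lc : lc patterns.
Proof.
rewrite /patterns; elim: (T :: Qs) => [|Q s IH] /=; first exact: lc_cst.
by apply: (lc_comp2 cons) => //; exact: lc_cls_map (pos_lc e S).
Qed.

Lemma subQS j : subfcr (QQ j) S.
Proof. by case: j => [|j] x y; [exact: TS|move=> /QsT/TS]. Qed.

Lemma patterns_mem j y z : (j < size (T :: Qs))%N -> z \in S y ->
  (z \in QQ j y) = (ps z \in nth [::] (patterns y) j).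
Proof.
move=> js zy; rewrite (nth_map T)//; apply/idP/mapP => [zQ|[w wQ pw]].
  by exists z.
suff -> : z = w by [].
have wy := subQS wQ; apply: (pos_inj (T := S)) => //.
by apply: cls_trans zy; apply: cls_sym.
Qed.

(** Makes the [S]-classes of [x0] and [x1] differ in type, so that a base position can be prescribed
    in both. *)
Lemma step_separating : exists k, forall d, d \in S x0 -> cell e k d <> cell e k x1.
Proof.
have [|k uk] := @sep_seq X e (x1 :: S x0); first by rewrite /= x01 cls_uniq.
exists k => d dx0 E; move: uk => /= /andP[/mapP + _]; apply.
by exists d.
Qed.

(* Inside each [S]-class the blocks of [T] are moved rigidly: [psi] transports
   the representative of every block from the base point of the class by a map
   inside the classes of [R p] ([th]), and extends it to the block by holonomy. *)
Lemma step_homeo : exists p (psi : homeo X X),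
  [/\ forall x, c (psi x) = c x,
      forall j x y, (psi y \in nth T Qs j (psi x)) = (y \in nth T Qs j x),
      psi x0 = x0 /\ psi x1 = x1,
      forall x y, y \in S x -> psi y \in R p (psi x) &
      forall f : X -> int, lc f -> exists q, null (R q) (fun x => f (psi x) - f x)].
Proof.
have [k ck] := step_separating.
(* The colour to be preserved: [c] bounds the size of the correction, the cell code separates [x0]
   from [x1], and [patterns] records the earlier relations. The list [tau] of colours is the type of
   an [S]-class. *)
pose phi y := (c y, cell e k y, patterns y).
have phi_lc : lc phi.
  by apply: lc_pair; [apply: lc_pair => //; exact: cell_lc|exact: patterns_lc].
pose tau x := map phi (S x).
have tau_lc : lc tau by exact: lc_cls_map.
have tau_size x : size (tau x) = size (S x) by rewrite size_map.
have tau_eq x y : y \in S x -> tau y = tau x by move=> yx; rewrite /tau (cls_eq yx).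
have tau_h i x : tau (h i x) = tau x by apply/tau_eq/hol_in.
have size_h i x : size (S (h i x)) = size (S x) by rewrite -!tau_size tau_h.
have phi_tau x y : tau x = tau y -> ps x = ps y -> phi x = phi y.
  have phiE z : phi z = nth (phi x) (tau z) (ps z).
    by rewrite (nth_map x) ?pos_lt// (set_nth_default z) ?pos_lt// -/(h _ _) hol_pos.
  by move=> txy pxy; rewrite phiE txy pxy -phiE.
(* Base position in a class of type [t]. Taking the positions of [x0] and [x1] for their own types
   is what lets the correction fix both points. *)
pose i0 t := if t == tau x0 then ps x0 else if t == tau x1 then ps x1 else 0%N.
have i0_lt x : (i0 (tau x) < size (S x))%N.
  rewrite -tau_size /i0; case: eqP => [->|_]; first by rewrite tau_size pos_lt.
  case: eqP => [->|_]; first by rewrite tau_size pos_lt.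
  by rewrite tau_size (leq_ltn_trans _ (pos_lt S x)).
have i0_x0 : i0 (tau x0) = ps x0 by rewrite /i0 eqxx.
have i0_x1 : i0 (tau x1) = ps x1.
  rewrite /i0 eqxx; case: eqP => // t01.
  have : phi x1 \in tau x0 by rewrite -t01 map_f ?cls_self.
  by move=> /mapP [d dx0 [_ E _]]; case: (ck d dx0).
pose pat0 (t : seq (nat * nat * seq (seq nat))) i :=
  nth [::] (nth (0, 0, [::])%N t i).2 0.
(* Position representing the [T]-block of position [i]: the base position if it lies in the block,
   otherwise the first one listed. *)
pose rho t i := if i0 t \in pat0 t i then i0 t else head 0%N (pat0 t i).
have pat0E x i : (i < size (S x))%N -> pat0 (tau x) i = map ps (T (h i x)).
  move=> ix; rewrite /pat0 (nth_map x)//.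
have pat0_mem x i j : (i < size (S x))%N -> (j < size (S x))%N ->
    (j \in pat0 (tau x) i) = (h j x \in T (h i x)).
  move=> ix jx; rewrite (@patterns_mem 0) ?pos_hol//.
    by rewrite /patterns /= pat0E.
  by apply: cls_trans (hol_in S j x); apply/cls_sym/hol_in.
have rho_lt x i : (i < size (S x))%N -> (rho (tau x) i < size (S x))%N.
  move=> ix; rewrite /rho; case: ifP => // _; rewrite pat0E//.
  have := cls_self T (h i x); have : forall y, y \in T (h i x) -> (ps y < size (S x))%N.
    move=> y /TS yx; have := pos_lt S y.
    by rewrite (cls_eq (cls_trans (hol_in S i x) yx)).
  by case: (T (h i x)) => //= y s H _; apply: H; rewrite inE eqxx.
have rho_mem x i : (i < size (S x))%N -> h (rho (tau x) i) x \in T (h i x).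
  move=> ix; rewrite -pat0_mem//; last exact: rho_lt.
  rewrite /rho; case: ifP => // _; rewrite pat0E//.
  by have := cls_self T (h i x); case: (T (h i x)) => //= y s _; rewrite inE eqxx.
have rho_eq x i j : (i < size (S x))%N -> (j < size (S x))%N ->
    h j x \in T (h i x) -> rho (tau x) j = rho (tau x) i.
  by move=> ix jx /cls_eq E; rewrite /rho !pat0E// E.
have rho_i0 x : rho (tau x) (i0 (tau x)) = i0 (tau x).
  by rewrite /rho pat0_mem// cls_self.
pose D t i y := (tau y == t) && (ps y == i).
have D_lc t i : lc (D t i).
  apply: (lc_comp2 (fun a b => (a == t) && (b == i)) tau_lc).
  exact: pos_lc.
have Dh t i j y : D t i y -> (j < size (S y))%N -> D t j (h j y).
  by move=> /andP[/eqP <- _] jy; rewrite /D tau_h eqxx pos_hol/=.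
have Dh_size t i y z : D t i y -> tau z = t -> size (S y) = size (S z).
  by move=> /andP[/eqP + _] zt; rewrite -tau_size => ->; rewrite -zt tau_size.
have hK i j y : ps y = i -> (i < size (S y))%N -> h i (h j y) = y.
  by move=> <- iy; rewrite hol_hol// hol_pos.
have Dsize t i y : D t i y -> (i < size (S y))%N.
  by move=> /andP[_ /eqP <-]; exact: pos_lt.
have move_h t i j (f : X -> int) (V : fcr X) :
    (forall y, D t i y -> (j < size (S y))%N /\ h j y \in V y) ->
    (forall y, D t j y -> (i < size (S y))%N) ->
    null V (fun y => (if D t i y then f (h j y) else 0) - (if D t j y then f y else 0)).
  move=> Hi Hj; apply: null_move.
  - by move=> y Dy; have [jy ?] := Hi y Dy; split => //; exact: Dh Dy jy.
  - move=> y z Dy Dz E.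
    case/andP: (Dy) => _ /eqP py; case/andP: (Dz) => _ /eqP pz.
    by rewrite -(hK i j y py (Dsize _ _ _ Dy)) E (hK i j z pz (Dsize _ _ _ Dz)).
  - move=> y Dy; exists (h i y); first by apply: (Dh _ _ _ _ Dy); exact: Hj.
    case/andP: (Dy) => _ /eqP py; exact: hK py (Dsize _ _ _ Dy).
(* Both sets meet each [S]-class of this type exactly once and no other class, so the difference is
   [S]-null, hence null for some [R p], uniformly by compactness. *)
have [p [pn0 Hp]] : exists p, (n0 <= p)%N /\ forall x,
    null (R p) (fun y => (D (tau x) (i0 (tau x)) y)%:R - (D (tau x) (ps x) y)%:R).
  have [||p Hp] := @compact_uniform X e (fun p x =>
    null (R p) (fun y => (D (tau x) (i0 (tau x)) y)%:R - (D (tau x) (ps x) y)%:R)).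
  - by move=> a b x ab; apply: null_mono; exact: fcr_monoW.
  - move=> x; have [||p Hp] := @S_null
      (fun y => (D (tau x) (i0 (tau x)) y)%:R - (D (tau x) (ps x) y)%:R).
    + apply: (lc_comp2 (fun a b : bool => a%:R - b%:R)); exact: D_lc.
    + have := @move_h (tau x) (i0 (tau x)) (ps x) (fun=> 1) S.
      have eqs y i : D (tau x) i y -> size (S y) = size (S x).
        by move=> Dy; exact: Dh_size Dy erefl.
      move=> H y; rewrite -[RHS](H _ _ y).
      * by apply: eq_bigr => z _; do 2 case: (D _ _ z).
      * by move=> z /eqs ->; rewrite pos_lt hol_in.
      * by move=> z /eqs ->.
    + exists p; have := tau_lc x; have := pos_lc e S x.
      by apply: filterS2 => z -> ->.
  - exists (maxn n0 p); rewrite leq_maxl; split => // x.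
    by apply: null_mono (Hp x); apply: fcr_monoW; rewrite leq_maxr.
(* [th (t, j)] carries base points of type [t] onto the points at position [j], inside the classes
   of [R p]; at the base position it is the identity, so that [x0] and [x1] will not move. *)
have /choice [th Hth] : forall tj, exists s : homeo X X,
    (tj.2 = i0 tj.1 -> forall x, s x = x) /\
    ((exists x, tau x = tj.1 /\ ps x = tj.2) ->
      forall d, s d \in R p d /\ D tj.1 tj.2 (s d) = D tj.1 (i0 tj.1) d).
  move=> [t j] /=; have [->|ji0] := eqVneq j (i0 t).
    by exists (hid X); split => // _ d; split => //; exact: cls_self.
  have [[x [tx px]]|nx] := pselect (exists x, tau x = t /\ ps x = j).
    rewrite -tx -px in ji0 *; have [s Hs] := fcr_match_set e (D_lc (tau x) (i0 (tau x))) (D_lc (tau x) (ps x)) (Hp x).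
    by exists s; split => // E; case/eqP: ji0.
  by exists (hid X); split => // E; case/eqP: ji0.
have th_id t x : th (t, i0 t) x = x by have [+ _] := Hth (t, i0 t); apply.
have th_spec x j d : (j < size (S x))%N ->
    th (tau x, j) d \in R p d /\ D (tau x) j (th (tau x, j) d) = D (tau x) (i0 (tau x)) d.
  move=> jx; have [_ +] := Hth (tau x, j); apply => /=.
  by exists (h j x); rewrite tau_h pos_hol.
(* From the base point, [th] reaches the representative of the block in a possibly different
   [S]-class of the same type; holonomy there restores the position of [x]. The inverse [chi]
   retraces this path. *)
pose psi x := h (ps x) (th (tau x, rho (tau x) (ps x)) (h (i0 (tau x)) x)).
pose chi x := h (ps x) (hinv (th (tau x, rho (tau x) (ps x))) (h (rho (tau x) (ps x)) x)).
pose mid x := th (tau x, rho (tau x) (ps x)) (h (i0 (tau x)) x).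
have Dself x : D (tau x) (ps x) x by rewrite /D !eqxx.
have rho_ps x : (rho (tau x) (ps x) < size (S x))%N by apply/rho_lt/pos_lt.
have Dmid x : D (tau x) (rho (tau x) (ps x)) (mid x).
  have [_ ->] := @th_spec x _ (h (i0 (tau x)) x) (rho_ps x).
  exact: Dh (Dself x) (i0_lt x).
have tmid x : tau (mid x) = tau x by case/andP: (Dmid x) => /eqP.
have pmid x : ps (mid x) = rho (tau x) (ps x) by case/andP: (Dmid x) => _ /eqP.
have smid x : size (S (mid x)) = size (S x) by rewrite -!tau_size tmid.
have psiE x : psi x = h (ps x) (mid x) by [].
have tpsi x : tau (psi x) = tau x by rewrite psiE tau_h tmid.
have ppsi x : ps (psi x) = ps x by rewrite psiE pos_hol// smid pos_lt.
pose dim x := hinv (th (tau x, rho (tau x) (ps x))) (h (rho (tau x) (ps x)) x).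
have Ddim x : D (tau x) (i0 (tau x)) (dim x).
  have [_ <-] := @th_spec x _ (dim x) (rho_ps x).
  by rewrite /dim hinvK; exact: Dh (Dself x) (rho_ps x).
have tdim x : tau (dim x) = tau x by case/andP: (Ddim x) => /eqP.
have pdim x : ps (dim x) = i0 (tau x) by case/andP: (Ddim x) => _ /eqP.
have sdim x : size (S (dim x)) = size (S x) by rewrite -!tau_size tdim.
have chiE x : chi x = h (ps x) (dim x) by [].
have tchi x : tau (chi x) = tau x by rewrite chiE tau_h tdim.
have pchi x : ps (chi x) = ps x by rewrite chiE pos_hol// sdim pos_lt.
have psiK : cancel psi chi.
  move=> x; rewrite /chi tpsi ppsi psiE.
  rewrite (hK _ _ (mid x)) ?pmid ?smid// /mid hfunK.
  by rewrite hK// pos_lt.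
have chiK : cancel chi psi.
  move=> x; rewrite /psi tchi pchi chiE.
  rewrite (hK _ _ (dim x)) ?pdim ?sdim// /dim hinvK.
  by rewrite hK// pos_lt.
have near_tp x : \forall z \near x, tau z = tau x /\ ps z = ps x.
  by have := tau_lc x; have := pos_lc e S x; apply: filterS2.
have cpsi : continuous psi.
  apply: continuous_local => x.
  exists (h (ps x) \o (th (tau x, rho (tau x) (ps x)) \o h (i0 (tau x)))).
    apply: continuous_compose; last exact: hol_continuous.
    by apply: continuous_compose; [exact: hol_continuous|exact: hfun_cont].
  by have := near_tp x; apply: filterS => z [tz pz]; rewrite /psi tz pz.
have cchi : continuous chi.
  apply: continuous_local => x.
  exists (h (ps x) \o (hinv (th (tau x, rho (tau x) (ps x))) \o h (rho (tau x) (ps x)))).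
    apply: continuous_compose; last exact: hol_continuous.
    by apply: continuous_compose; [exact: hol_continuous|exact: hinv_cont].
  by have := near_tp x; apply: filterS => z [tz pz]; rewrite /chi tz pz.
pose H := Homeo psiK chiK cpsi cchi.
(* [mid] depends only on the [T]-block, so a whole block lands in a single [S]-class. *)
have mid_eq x y : y \in T x -> mid y = mid x.
  move=> yx; have yS := TS yx; rewrite /mid (tau_eq _ _ yS) (hol_eq _ yS)//.
  congr (hfun (th _) _); congr pair; apply: rho_eq; rewrite ?pos_lt//.
    by rewrite -(cls_eq yS) pos_lt.
  by rewrite hol_pos -(hol_eq _ yS) ?hol_pos// -(cls_eq yS) pos_lt.
have phi_psi x : phi (psi x) = phi x by apply: phi_tau.
have psi_S x y : y \in T x -> psi y \in S (psi x).
  move=> yx; rewrite psiE (mid_eq _ _ yx) psiE (cls_eq (hol_in _ _ _)).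
  exact: hol_in.
have psi_Q j x y : (j < size (T :: Qs))%N -> y \in QQ j x -> psi y \in QQ j (psi x).
  move=> js yx; have yT : y \in T x by case: j js yx => // j js /QsT.
  rewrite patterns_mem//; last exact: psi_S.
  have -> : patterns (psi x) = patterns x := congr1 snd (phi_psi x); rewrite ppsi -patterns_mem//; exact: TS.
have mid_eq' x y : y \in T x -> dim y = dim x.
  move=> yx; have yS := TS yx.
  have rr : rho (tau x) (ps y) = rho (tau x) (ps x).
    apply: rho_eq; rewrite ?pos_lt//; first by rewrite -(cls_eq yS) pos_lt.
    by rewrite hol_pos -(hol_eq _ yS) ?hol_pos// -(cls_eq yS) pos_lt.
  by rewrite /dim (tau_eq _ _ yS) rr (hol_eq _ yS).
have phi_chi x : phi (chi x) = phi x by apply: phi_tau.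
have chi_S x y : y \in T x -> chi y \in S (chi x).
  move=> yx; rewrite chiE (mid_eq' _ _ yx) chiE (cls_eq (hol_in _ _ _)).
  exact: hol_in.
have chi_Q j x y : (j < size (T :: Qs))%N -> y \in QQ j x -> chi y \in QQ j (chi x).
  move=> js yx; have yT : y \in T x by case: j js yx => // j js /QsT.
  rewrite patterns_mem//; last exact: chi_S.
  have -> : patterns (chi x) = patterns x := congr1 snd (phi_chi x); rewrite pchi -patterns_mem//; exact: TS.
have mid_T x : psi x \in T (mid x).
  rewrite psiE; have := @rho_mem (mid x) (ps x).
  rewrite smid pos_lt tmid => /(_ erefl) H0; apply: cls_sym.
  by move: H0; rewrite -pmid hol_pos.
have mid_R x : mid x \in R p (h (i0 (tau x)) x).
  by have [] := @th_spec x _ (h (i0 (tau x)) x) (rho_ps x).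
have TRp : subfcr T (R p) by move=> x y /TR; exact: fcr_monoW.
exists p, H; split => /=.
- by move=> x; have [] := phi_psi x.
- move=> j x y.
  have [j' js <-] : exists2 j', (j' < size (T :: Qs))%N & QQ j' = nth T Qs j.
    have [js|sj] := ltnP j (size Qs); first by exists j.+1.
    by exists 0%N => //; rewrite [RHS]nth_default.
  by apply/idP/idP => [/(chi_Q _ _ _ js)|/(psi_Q _ _ _ js)//]; rewrite !psiK.
- split; rewrite /psi -?i0_x0 -?i0_x1 rho_i0 th_id.
    by rewrite i0_x0 hol_pos hol_pos.
  by rewrite i0_x1 hol_pos hol_pos.
(* Both images are linked in [R p] to the common base point of the [S]-class. *)
- move=> x y yx; have E : h (i0 (tau y)) y = h (i0 (tau x)) x.
    by rewrite (tau_eq _ _ yx) (hol_eq _ yx).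
  have H1 := mid_R x; have := mid_R y; rewrite E => H2.
  have K1 := TRp _ _ (mid_T x); have K2 := TRp _ _ (mid_T y).
  rewrite (cls_eq (cls_trans H1 K1)); exact: cls_trans H2 K2.
move=> f lf.
have [||q Hq] := @compact_uniform X e (fun q x => null (R q)
    (fun y => if (tau y, ps y) == (tau x, ps x) then f (psi y) - f y else 0)).
- by move=> a b x ab; apply: null_mono; exact: fcr_monoW.
(* At a fixed type and position the variation of [f] telescopes along three moves: holonomy to the
   base point inside [S], then [th] inside [R p], then holonomy from the representative inside [T].
   For the first, [S_null] supplies the index [q]. *)
- move=> x; pose t := tau x; pose i := ps x; pose r := rho t i.
  have eqs y j : D t j y -> size (S y) = size (S x).
    by move=> Dy; exact: Dh_size Dy erefl.
  pose f1 := f \o (h i \o th (t, r)); pose f2 := f \o h i.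
  have lf1 : lc f1.
    apply: lc_precomp lf; apply: continuous_compose; last exact: hol_continuous.
    exact: hfun_cont.
  have [||q Hq] := @S_null (fun y => (if D t i y then f1 (h (i0 t) y) else 0)
      - (if D t (i0 t) y then f1 y else 0)).
  + have l1 := @lc_precomp _ _ _ f1 _ (@hol_continuous _ S (i0 t)) lf1.
    apply: (lc_comp2 (fun a b => a - b)).
      exact: (lc_comp2 (fun (a : bool) b => if a then b else 0) (@D_lc t i) l1).
    exact: (lc_comp2 (fun (a : bool) b => if a then b else 0) (@D_lc t (i0 t)) lf1).
  + apply: move_h => [y /eqs ->|y /eqs ->]; rewrite ?pos_lt// hol_in.
    by rewrite i0_lt.
  have N2 : null (R p) (fun y => (if D t (i0 t) y then f2 (th (t, r) y) else 0)
      - (if D t r y then f2 y else 0)).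
    apply: null_move => [y Dy|y z _ _|y Dy].
    + have [K1 ->] := @th_spec x r y (rho_ps x).
      by split.
    + by move=> /(can_inj (hfunK _)).
    + exists (hinv (th (t, r)) y); last by rewrite hinvK.
      have [_ <-] := @th_spec x r (hinv (th (t, r)) y) (rho_ps x).
      by rewrite hinvK.
  have N3 : null (R p) (fun y => (if D t r y then f (h i y) else 0)
      - (if D t i y then f y else 0)).
    apply: move_h => [y Dy|y /eqs ->]; last exact: rho_ps.
    rewrite (eqs _ _ Dy) pos_lt; split => //; apply: TRp.
    case/andP: Dy => /eqP ty /eqP py; have sy : size (S y) = size (S x).
      by rewrite -!tau_size ty.
    apply: cls_sym; have := @rho_mem y i; rewrite ty sy pos_lt -/r -py hol_pos.
    by apply.
  exists (maxn p q); have := near_tp x; apply: filterS => z [-> ->].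
  have Hq' := null_mono (fcr_monoW (leq_maxr p q)) Hq.
  have pq := fcr_monoW (leq_maxl p q).
  have N2' := null_mono pq N2; have N3' := null_mono pq N3.
  have := nullD (nullD Hq' N2') N3' => NN y; rewrite -[RHS](NN y).
  apply: eq_bigr => w _; rewrite /f1 /f2 /= -/t -/i xpair_eqE -/(D t i w).
  have [Dw|] := boolP (D t i w); last by lia.
  have -> : psi w = h i (th (t, r) (h (i0 t) w)).
    by case/andP: Dw => /eqP tw /eqP pw; rewrite /psi tw pw.
  by lia.
- exists q; apply: (null_colours (K := fun y => (tau y, ps y))); exact: Hq.
Qed.

End Step.

(** * Intertwining two increasing sequences of relations *)

Lemma choice_seq (A : Type) (I : A -> Prop) (step : nat -> A -> A -> Prop) (a0 : A) :
  I a0 -> (forall k a, I a -> exists2 a', I a' & step k a a') ->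
  exists u : nat -> A, u 0%N = a0 /\ forall k, I (u k) /\ step k (u k) (u k.+1).
Proof.
move=> I0 H.
have /choice [nx Hnx] : forall ka, exists a', I ka.2 -> I a' /\ step ka.1 ka.2 a'.
  move=> [k a] /=; have [Ia|nIa] := pselect (I a); last by exists a.
  by have [a' ? ?] := H k a Ia; exists a'.
pose u := fix u k := if k is k'.+1 then nx (k', u k') else a0.
have Iu k : I (u k) by elim: k => [//|k IH]; have [] := Hnx (k, u k) IH.
by exists u; split => // k; split => //; have [] := Hnx (k, u k) (Iu k).
Qed.

Lemma nth_mapf (A B : Type) (f : A -> B) (a : A) s j :
  nth (f a) (map f s) j = f (nth a s j).
Proof. by elim: s j => [|b s IH] [|j] //=. Qed.

Definition Bnull (X : topologicalType) (R : nat -> fcr X) (f : X -> int) :=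
  exists p, null (R p) f.

Definition fcr_id (X : topologicalType) : fcr X.
Proof.
refine (@Fcr X (fun x => [:: x]) _ _ _ _).
- by move=> x; rewrite inE.
- by move=> x y; rewrite inE => /eqP ->.
- by [].
- move=> x; exists 1%N, (fun _ => id); split; first by move=> i y; exact: cvg_id.
  by near=> z.
Unshelve. all: by end_near. Defined.

(** Cell codes of a class are locally constant, so a point outside the class of [u] stays separated
    from the classes of all points near [u]. *)
Lemma fcr_closed (X : topologicalType) (e : bits X) (T : fcr X) (u v : X) (k0 : nat) :
  (forall k, (k0 <= k)%N -> exists u' v', [/\ cell e k u' = cell e k u,
     cell e k v' = cell e k v & v' \in T u']) -> v \in T u.
Proof.
move=> H; apply/negPn/negP => nv.
have [|K uK] := @sep_seq X e (v :: T u); first by rewrite /= nv cls_uniq.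
have [l Hl] := lc_cell e (lc_cls_map T (cell_lc e K)).
have [|u' [v' [cu cv vu]]] := H (maxn k0 (maxn K l)); first by rewrite leq_maxl.
move: uK; rewrite map_cons cons_uniq => /andP[/negP + _]; apply.
have kK : (K <= maxn k0 (maxn K l))%N by rewrite leq_max leq_maxl orbT.
have kl : (l <= maxn k0 (maxn K l))%N by rewrite leq_max leq_maxr orbT.
rewrite -(cellW kK cv) -(Hl _ _ (cellW kl cu)).
exact: map_f.
Qed.

Definition matched (X Y : topologicalType) (F : homeo X Y) (q : fcr X * fcr Y) :=
  forall x y, (F y \in q.2 (F x)) = (y \in q.1 x).

(** An index past the end of [L] returns [top], so the condition covers [top] itself. *)
Definition chain (X Y : topologicalType) (F : homeo X Y) (top : fcr X * fcr Y)
    (L : seq (fcr X * fcr Y)) :=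
  forall j, matched F (nth top L j) /\ subfcr (nth top L j).1 top.1.

Definition preservesB (X Y : topologicalType) (R : nat -> fcr X) (S : nat -> fcr Y)
    (F : homeo X Y) :=
  forall f : X -> int, lc f -> (Bnull R f <-> Bnull S (f \o hinv F)).

Definition close (X Y : topologicalType) (eX : bits X) (eY : bits Y) (k : nat)
    (F G : homeo X Y) :=
  (forall x, cell eY k (G x) = cell eY k (F x)) /\
  (forall y, cell eX k (hinv G y) = cell eX k (hinv F y)).

Definition inchain (A : Type) (top : A) (L : seq A) (q : A) :=
  exists j, nth top L j = q.

Section HalfStep.
Variables (X Y : topologicalType) (eX : bits X) (eY : bits Y).
Variables (R : nat -> fcr X) (S : nat -> fcr Y) (x0 x1 : X).
Hypothesis R_mono : forall n, subfcr (R n) (R n.+1).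

(** By [preservesB], functions null for the pullback of [S m] are null for some relation of [R],
    which is the input of [step_homeo]. Composing [F] with the inverse of [psi] puts the new
    pullback inside a single [R p]. *)
Lemma half_step (F : homeo X Y) top L (k m : nat) :
  chain F top L -> preservesB R S F -> F x1 \notin S m (F x0) ->
  (exists n, subfcr top.1 (R n)) -> subfcr top.2 (S m) ->
  exists (F' : homeo X Y) p, let top' := (fcr_pull F' (S m), S m) in
    [/\ chain F' top' (top :: L), preservesB R S F', F' x0 = F x0 /\ F' x1 = F x1,
        close eX eY k F F' & subfcr (fcr_pull F' (S m)) (R p)].
Proof.
move=> chL pB n01 [n0 tR] tS.
have [mtop _] : matched F top /\ subfcr top.1 top.1.
  by have := chL (size L); rewrite nth_default.
pose c x := pickle (cell eX k x, cell eY k (F x)).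
have c_lc : lc c.
  apply: (lc_comp pickle); apply: lc_pair; first exact: cell_lc.
  exact: lc_precomp (@hfun_cont _ _ F) (cell_lc eY k).
have [|||||p [psi [cpsi Qpsi [psi0 psi1] Spsi Bpsi]]] :=
  @step_homeo X eX R (fcr_pull F (S m)) top.1 (map fst L) n0 x0 x1 c R_mono _ _ _ _ _ c_lc.
- move=> f lf /null_pull nf; apply/pB => //; by exists m.
- by move=> x y yx; rewrite mem_pull; apply: tS; rewrite mtop.
- exact: tR.
- by move=> j; rewrite nth_mapf; have [] := chL j.
- by rewrite mem_pull.
pose F' := hcomp F (hsym psi).
have F'E x : F' x = F (hinv psi x) by [].
have mF' j : matched F' (nth top L j).
  move=> x y; have [mj _] := chL j; rewrite !F'E mj.
  by rewrite -[in RHS](hinvK psi x) -[in RHS](hinvK psi y) -nth_mapf Qpsi.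
have hpsi0 : hinv psi x0 = x0 by rewrite -{1}psi0 hfunK.
have hpsi1 : hinv psi x1 = x1 by rewrite -{1}psi1 hfunK.
have mtop' : matched F' top by have := mF' (size L); rewrite nth_default.
have cE x : (cell eX k (psi x) = cell eX k x) /\ (cell eY k (F (psi x)) = cell eY k (F x)).
  by have := cpsi x => /(pcan_inj pickleK) [].
exists F', p; split.
- have sub1 : subfcr top.1 (fcr_pull F' (S m)).
    by move=> x y yx; rewrite mem_pull; apply: tS; rewrite mtop'.
  have mnew : matched F' (fcr_pull F' (S m), S m) by move=> x y; rewrite mem_pull.
  case=> [|j]; first by split.
  have [jL|Lj] := ltnP j (size L).
    rewrite /= (set_nth_default top)//; split => //.
    by move=> x y yx; apply: sub1; have [_] := chL j; apply.
  by rewrite /= nth_default; last by []; split.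
- move=> f lf; have lfp : lc (f \o psi) by exact: lc_precomp (@hfun_cont _ _ psi) lf.
  have [q Hq] := Bpsi f lf; have E := pB _ lfp.
  have -> : Bnull S (f \o hinv F') <-> Bnull S ((f \o psi) \o hinv F) by [].
  rewrite -E; split => -[r nr]; exists (maxn q r).
    have := nullD (null_mono (fcr_monoW R_mono (leq_maxl q r)) Hq)
      (null_mono (fcr_monoW R_mono (leq_maxr q r)) nr).
    by move=> N x; rewrite -[RHS](N x); apply: eq_bigr => y _ /=; rewrite subrK.
  have := nullB (null_mono (fcr_monoW R_mono (leq_maxr q r)) nr)
    (null_mono (fcr_monoW R_mono (leq_maxl q r)) Hq).
  by move=> N x; rewrite -[RHS](N x); apply: eq_bigr => y _ /=; rewrite opprB addrC subrK.
- by rewrite !F'E hpsi0 hpsi1.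
- split => [x|y] /=.
    by have [_ <-] := cE (hinv psi x); rewrite hinvK.
  by have [-> _] := cE (hinv F y).
- move=> x y; rewrite mem_pull !F'E => H.
  have := Spsi (hinv psi x) (hinv psi y); rewrite mem_pull !hinvK; exact.
Qed.

End HalfStep.

Lemma matched_sym (X Y : topologicalType) (F : homeo X Y) q :
  matched F q -> matched (hsym F) (q.2, q.1).
Proof. by move=> mq x y /=; rewrite -mq !hinvK. Qed.

Lemma chain_sym (X Y : topologicalType) (F : homeo X Y) top L :
  chain F top L -> chain (hsym F) (top.2, top.1) [seq (q.2, q.1) | q <- L].
Proof.
move=> ch j; rewrite (nth_mapf (fun q => (q.2, q.1))).
have [mj sj] := ch j; split; first exact: matched_sym.
have [mt _] : matched F top /\ subfcr top.1 top.1.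
  by have := ch (size L); rewrite nth_default.
move=> x y /=; rewrite -{1}(hinvK F x) -{1}(hinvK F y) mj => /sj.
by rewrite -mt !hinvK.
Qed.

Lemma preservesB_sym (X Y : topologicalType) R S (F : homeo X Y) :
  preservesB R S F -> preservesB S R (hsym F).
Proof.
move=> pB f lf; have lF : lc (f \o F) by exact: lc_precomp (@hfun_cont _ _ F) lf.
have := pB _ lF; suff -> : (f \o F) \o hinv F = f by move=> ->.
by apply: funext => y /=; rewrite hinvK.
Qed.

Section Intertwine.
Variables (X Y : topologicalType) (eX : bits X) (eY : bits Y).
Variables (R : nat -> fcr X) (S : nat -> fcr Y) (x0 x1 : X) (y0 y1 : Y).
Hypothesis R_mono : forall n, subfcr (R n) (R n.+1).
Hypothesis S_mono : forall n, subfcr (S n) (S n.+1).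
Hypothesis x01 : forall n, x1 \notin R n x0.
Hypothesis y01 : forall n, y1 \notin S n y0.

Record istate := IState { iF : homeo X Y; itop : fcr X * fcr Y; iL : seq (fcr X * fcr Y) }.

Definition iinv (s : istate) :=
  [/\ chain (iF s) (itop s) (iL s), preservesB R S (iF s),
      iF s x0 = y0 /\ iF s x1 = y1, exists n, subfcr (itop s).1 (R n) &
      exists m, subfcr (itop s).2 (S m)].

(** Matched pairs are never lost, and the last two clauses make them cofinal in both [S] and [R]. *)
Definition istep (k : nat) (s s' : istate) :=
  [/\ forall q, inchain (itop s) (iL s) q -> inchain (itop s') (iL s') q,
      close eX eY k (iF s) (iF s'),
      exists m Q p, [/\ (k <= m)%N, inchain (itop s') (iL s') (Q, S m) & subfcr Q (R p)] &
      exists n Q m, [/\ (k <= n)%N, inchain (itop s') (iL s') (R n, Q) & subfcr Q (S m)]].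

Lemma inchain_cons (A : Type) (t top : A) L q :
  inchain top L q -> inchain t (top :: L) q.
Proof.
move=> [j <-]; have [jL|Lj] := ltnP j (size L).
  by exists j.+1; rewrite /=; exact: set_nth_default.
by exists 0%N; rewrite /= nth_default.
Qed.

Lemma inchain_top (A : Type) (top : A) L : inchain top L top.
Proof. by exists (size L); rewrite nth_default. Qed.

Lemma istep_exists k s : iinv s -> exists2 s', iinv s' & istep k s s'.
Proof.
case: s => F top L [/= ch pB [F0 F1] tR [m0 tS]].
have {}tS : subfcr top.2 (S (maxn k m0)).
  by move=> x y /tS; apply: fcr_monoW => //; rewrite leq_maxr.
set m := maxn k m0 in tS.
have [|F' [p /= [ch' pB' [F0' F1'] cl' sp]]] :=
  @half_step X Y eX eY R S x0 x1 R_mono F top L k m ch pB _ tR tS.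
  by rewrite F0 F1.
have {}sp : subfcr (fcr_pull F' (S m)) (R (maxn k p)).
  by move=> x y /sp; apply: fcr_monoW => //; rewrite leq_maxr.
set n := maxn k p in sp.
rewrite F0 in F0'; rewrite F1 in F1'.
have h0 : hinv F' y0 = x0 by rewrite -F0' hfunK.
have h1 : hinv F' y1 = x1 by rewrite -F1' hfunK.
have [|||G [m' /= [ch2 pB2 [G0 G1] cl2 sm]]] :=
  @half_step Y X eY eX S R y0 y1 S_mono (hsym F') _ _ k n
    (chain_sym ch') (preservesB_sym pB').
- by rewrite /= h0 h1.
- by exists m.
- exact: sp.
pose F2 := hsym G.
have FK x : F2 (G x) = x by apply: hinvK.
have ch3 : chain F2 (R n, fcr_pull G (R n)) [seq (q.2, q.1) | q <- [seq (q.2, q.1) |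
    q <- (fcr_pull F' (S m), S m) :: top :: L]] by exact: chain_sym ch2.
have LE : [seq (q.2, q.1) | q <- [seq (q.2, q.1) |
    q <- (fcr_pull F' (S m), S m) :: top :: L]] = (fcr_pull F' (S m), S m) :: top :: L.
  by rewrite -map_comp -[RHS]map_id; apply: eq_map; case.
rewrite LE in ch3.
exists (IState F2 (R n, fcr_pull G (R n)) ((fcr_pull F' (S m), S m) :: top :: L)).
  split => /=.
  - exact: ch3.
  - exact: preservesB_sym pB2.
  - split; [rewrite -h0 -G0|rewrite -h1 -G1]; exact: FK.
  - by exists n.
  - by exists m'.
split => /=.
- by move=> q qi; do 2 apply: inchain_cons.
- case: cl' => c1 c2; case: cl2 => c3 c4; split.
    by move=> x; rewrite -c1 -c4.
  by move=> y; rewrite -c2 -c3.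
- exists m, (fcr_pull F' (S m)), n; split => //; first by rewrite leq_maxl.
  by exists 0%N.
- exists n, (fcr_pull G (R n)), m'; split => //; first by rewrite leq_maxl.
  exact: inchain_top.
Qed.

Theorem intertwine (F0 : homeo X Y) :
  preservesB R S F0 -> F0 x0 = y0 -> F0 x1 = y1 ->
  exists F : homeo X Y, [/\ F x0 = y0, F x1 = y1,
    forall m, exists p, forall x y, F y \in S m (F x) -> y \in R p x &
    forall n, exists m, forall x y, y \in R n x -> F y \in S m (F x)].
Proof.
move=> pB F00 F01.
have I0 : iinv (IState F0 (fcr_id X, fcr_id Y) [::]).
  split => //=.
  - move=> j; rewrite nth_nil; split => // x y /=; rewrite !inE.
    by apply/eqP/eqP => [/(can_inj (hfunK F0))|->].
  - by exists 0%N => x y; rewrite inE => /eqP ->; exact: cls_self.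
  - by exists 0%N => x y; rewrite inE => /eqP ->; exact: cls_self.
have [u [_ Hu]] := choice_seq I0 istep_exists.
pose Fk k := iF (u k).
(* [P k] and [Q k] code the graph of [Fk k] at level [k], seen from either side; closeness of
   consecutive homeomorphisms makes the codes compatible. *)
pose P k x := pickle (cell eX k x, cell eY k (Fk k x)).
pose Q k y := pickle (cell eX k (hinv (Fk k) y), cell eY k y).
have QF k x : Q k (Fk k x) = P k x by rewrite /Q /P hfunK.
have cl k : close eX eY k (Fk k) (Fk k.+1) by have [_ []] := Hu k.
have [|||||||F HF] := @limit_homeo X Y eX eY P Q.
- move=> k; apply: (lc_comp pickle); apply: lc_pair; first exact: cell_lc.
  exact: lc_precomp (@hfun_cont _ _ _) (cell_lc eY k).
- move=> k; apply: (lc_comp pickle); apply: lc_pair; last exact: cell_lc.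
  exact: lc_precomp (@hinv_cont _ _ _) (cell_lc eX k).
- move=> x x' H; apply: (cell_sep (e := eX)) => k.
  by have /(pcan_inj pickleK) [] := H k.
- move=> x x' H; apply: (cell_sep (e := eY)) => k.
  by have /(pcan_inj pickleK) [] := H k.
- by move=> k x; exists (Fk k x).
- by move=> k y; exists (hinv (Fk k) y); rewrite -QF hinvK.
- move=> k x y /(pcan_inj pickleK) [E1 E2]; have [c1 c2] := cl k.
  congr pickle; congr pair.
    by rewrite -c2; apply: (@cellW _ eX k k.+1).
  by rewrite -c1; apply: (@cellW _ eY k k.+1).
have FX k x : cell eX k (hinv (Fk k) (F x)) = cell eX k x.
  by have /(pcan_inj pickleK) [] := HF k x.
have FY k x : cell eY k (F x) = cell eY k (Fk k x).
  by have /(pcan_inj pickleK) [] := HF k x.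
have persist k l q : (k <= l)%N -> inchain (itop (u k)) (iL (u k)) q ->
    inchain (itop (u l)) (iL (u l)) q.
  move=> /subnK <-; elim: (l - k)%N => [//|d IH] H.
  by have [_ [mon _ _ _]] := Hu (d + k)%N; apply/mon/IH.
(* Every later [Fk l] matches [q] and agrees with [F] up to cells of level [l] in both directions,
   so closedness of the relations passes the match to [F]. *)
have mF k q : inchain (itop (u k)) (iL (u k)) q -> matched F q.
  move=> qk; have mk l : (k <= l)%N -> matched (Fk l) q.
    move=> kl; have [[ch _ _ _ _] _] := Hu l.
    by have [j <-] := persist _ _ _ kl qk; have [] := ch j.
  move=> x y; apply/idP/idP => H.
    apply: (fcr_closed (e := eX) (k0 := k)) => l kl.
    exists (hinv (Fk l) (F x)), (hinv (Fk l) (F y)).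
    by split => //; rewrite -(mk l kl) !hinvK.
  apply: (fcr_closed (e := eY) (k0 := k)) => l kl.
  exists (Fk l x), (Fk l y).
  by split; rewrite ?FY// (mk l kl).
exists F; split.
- apply: (cell_sep (e := eY)) => k; rewrite FY.
  by have [[_ _ [-> _] _ _] _] := Hu k.
- apply: (cell_sep (e := eY)) => k; rewrite FY.
  by have [[_ _ [_ ->] _ _] _] := Hu k.
- move=> m; have [_ [_ _ [m' [Q' [p [mm' Qin Qp]]]] _]] := Hu m.
  exists p => x y /(fcr_monoW S_mono mm'); rewrite (mF _ _ Qin) => /Qp //.
- move=> n; have [_ [_ _ _ [n' [Q' [m [nn' Qin Qm]]]]]] := Hu n.
  exists m => x y /(fcr_monoW R_mono nn'); rewrite -(mF _ _ Qin) => /Qm //.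
Qed.

End Intertwine.

(** * Orbits of a minimal homeomorphism *)

Section Iterates.
Variables (X : topologicalType) (a : homeo X X).
Local Notation a' := (hinv a).

Lemma iter_cont (f : X -> X) n : continuous f -> continuous (iter n f).
Proof.
move=> cf; elim: n => [|n IH] /=; first by move=> x; exact: cvg_id.
exact: (continuous_compose IH cf).
Qed.

Lemma iterz_cont k : continuous (iterz a k).
Proof. by case: k => n; apply: iter_cont; [exact: hfun_cont|exact: hinv_cont]. Qed.

Lemma iter_back n x : iter n a (iter n a' x) = x.
Proof. by elim: n x => [//|n IH] x; rewrite iterSr /= hinvK IH. Qed.

Lemma back_iter n x : iter n a' (iter n a x) = x.
Proof. by elim: n x => [//|n IH] x; rewrite iterSr /= hfunK IH. Qed.

Lemma back_iter_sub m n x : (m <= n)%N -> iter m a' (iter n a x) = iter (n - m) a x.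
Proof. by move=> mn; rewrite -{1}(subnKC mn) iterD back_iter. Qed.

Lemma iter_back_sub m n x : (m <= n)%N -> iter m a (iter n a' x) = iter (n - m) a' x.
Proof. by move=> mn; rewrite -{1}(subnKC mn) iterD iter_back. Qed.

Lemma iterzN n x : iterz a (- n%:Z) x = iter n a' x.
Proof. by case: n. Qed.

Lemma iterzS k x : iterz a (k + 1) x = a (iterz a k x).
Proof.
case: k => n; first by rewrite -PoszD addn1.
case: n => [|n]; first by rewrite /= hinvK.
have -> : Negz n.+1 + 1 = Negz n by lia.
by rewrite /= hinvK.
Qed.

Lemma iterzP k x : iterz a (k - 1) x = a' (iterz a k x).
Proof. by rewrite -{2}(subrK 1 k) iterzS hfunK. Qed.

Lemma iterzD k l x : iterz a (k + l) x = iterz a k (iterz a l x).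
Proof.
elim/int_ind: k => [|n IH|n IH]; first by rewrite add0r.
  have -> : n.+1%:Z + l = (n%:Z + l) + 1 by lia.
  by rewrite iterzS IH -iterzS; congr iterz; lia.
have -> : - n.+1%:Z + l = (- n%:Z + l) - 1 by lia.
by rewrite iterzP IH -iterzP; congr iterz; lia.
Qed.

Lemma iterzK k x : iterz a (- k) (iterz a k x) = x.
Proof. by rewrite -iterzD addNr. Qed.

Lemma iterzVK k x : iterz a k (iterz a (- k) x) = x.
Proof. by rewrite -iterzD subrr. Qed.

End Iterates.

Section Minimal.
Variables (X : topologicalType) (e : bits X) (a : homeo X X).
Hypothesis mina : minimal a.
Local Notation a' := (hinv a).

Lemma closed_local (A : set X) :
  (forall x : X, ~ A x -> \forall z \near x, ~ A z) -> closed A.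
Proof.
move=> H x Ax; apply: contrapT => /H nA.
by have [z [Az]] := Ax _ nA.
Qed.

(** The points whose orbit avoids [E] form a closed invariant set that is not the whole space. *)
Lemma orbit_hits (E : pred X) : lc E -> (exists x, E x) ->
  forall x, exists k : int, E (iterz a k x).
Proof.
move=> lE [w Ew] x; apply: contrapT => nx.
pose A := [set z | forall k : int, ~~ E (iterz a k z)].
have Acl : closed A.
  apply: closed_local => z /existsNP [k /negP/negPn Ek].
  have := @lc_precomp _ _ _ E _ (@iterz_cont _ a k) lE z; apply: filterS => y /= Ey H.
  by have := H k; rewrite Ey Ek.
have Ainv : hfun a @` A = A.
  apply/seteqP; split => [_ [z Az <-]|z Az] => /=.
    move=> k; have := Az (k + 1); suff -> : iterz a (k + 1) z = iterz a k (a z) by [].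
    by rewrite iterzD.
  exists (a' z); last exact: hinvK.
  move=> k; have := Az (k - 1); suff -> : iterz a (k - 1) z = iterz a k (a' z) by [].
  by rewrite iterzD.
have [A0|AT] := mina Acl Ainv.
  have : A x by move=> k; apply/negP => Ek; apply: nx; exists k.
  by rewrite A0.
have : A w by rewrite AT.
by move=> /(_ 0); rewrite /= Ew.
Qed.

Lemma orbit_hits_bounded (E : pred X) : lc E -> (exists x, E x) ->
  exists N, forall x, (exists2 k, (k <= N)%N & E (iter k a x)) /\
    (exists2 k, (k <= N)%N & E (iter k a' x)).
Proof.
move=> lE neE.
have [||N HN] := @compact_uniform X e
    (fun N x => exists2 k : int, `|k| <= N%:Z & E (iterz a k x)).
- by move=> m n x mn [k km Ek]; exists k => //; apply: le_trans km _; rewrite lez_nat.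
- move=> x; have [k Ek] := orbit_hits lE neE x.
  exists (absz k); have := @lc_precomp _ _ _ E _ (@iterz_cont _ a k) lE x.
  by apply: filterS => z /= Ez; exists k; [lia|rewrite Ez].
(* Orbits meet [E] at a time between [-N] and [N]; centring this window at [N] or [-N] gives all
   times one sign. *)
exists (N + N)%N => x; split.
  have [k kN] := HN (iterz a N x); rewrite -iterzD => Ek.
  exists (absz (k + N%:Z)); first by lia.
  rewrite -[iter _ _ _]/(iterz a (absz (k + N%:Z))%:Z x).
  by have -> : (absz (k + N%:Z))%:Z = k + N%:Z by lia.
have [k kN] := HN (iterz a (- N%:Z) x); rewrite -iterzD => Ek.
exists (absz (k - N%:Z)); first by lia.
by rewrite -iterzN; have -> : - (absz (k - N%:Z))%:Z = k - N%:Z by lia.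
Qed.

(** A finite orbit is closed and invariant, hence the whole space, whose points would then be
    isolated. *)
Lemma aperiodic n x : (0 < n)%N -> iter n a x <> x.
Proof.
move=> n0 nx; pose s := undup (traject a x n).
have sP z : (z \in s) = (z \in traject a x n) by rewrite mem_undup.
have xs : x \in s by rewrite sP; case: n n0 {nx s sP} => // n _; rewrite /= inE eqxx.
have sa z : z \in s -> a z \in s.
  rewrite !sP => /trajectP [i ilt ->]; rewrite -iterS; have [E|ne] := eqVneq i.+1 n.
    by rewrite E nx -sP.
  by apply/trajectP; exists i.+1 => //; lia.
have sa' z : z \in s -> a' z \in s.
  rewrite !sP => /trajectP [[|i] ilt ->] /=.
    rewrite -{1}nx; case: n n0 {nx s sP xs sa ilt} => // n _; rewrite /= hfunK.
    by apply/(@trajectP _ a x n.+1); exists n.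
  by rewrite hfunK; apply/trajectP; exists i => //; lia.
have Acl : closed [set z | z \in s].
  apply: closed_local => z /negP zs.
  have [|K] := @sep_seq X e (z :: s); first by rewrite /= zs undup_uniq.
  rewrite map_cons cons_uniq => /andP[/negP nz _].
  by have := cell_lc e K z; apply: filterS => w cw ws; apply: nz; rewrite -cw map_f.
have Ainv : hfun a @` [set z | z \in s] = [set z | z \in s].
  apply/seteqP; split => [_ [z zs <-]|z zs] /=; first exact: sa.
  by exists (a' z); [exact: sa'|exact: hinvK].
have [A0|AT] := mina Acl Ainv; first by have : [set z | z \in s] x by []; rewrite A0.
have [K uK] := @sep_seq X e s (undup_uniq _).
have [y cy] := bits_perfect e (cell_lc e K x); apply.
have ys : y \in s by have : [set z | z \in s] y by rewrite AT.
rewrite -(nth_index y ys) -(nth_index y xs).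
by rewrite -(index_map_uniq uK ys) -(index_map_uniq uK xs) cy.
Qed.

Lemma iterz_inj k l x : iterz a k x = iterz a l x -> k = l.
Proof.
wlog kl : k l / k <= l.
  by move=> H E; have [/H|lk] := lerP k l; [exact|apply/esym/H => //; exact: ltW].
move=> E; apply: contrapT => nkl.
have : iterz a (l - k) x = x.
  by rewrite addrC iterzD -E iterzK.
have -> : l - k = (absz (l - k))%:Z by lia.
by apply: aperiodic; lia.
Qed.

End Minimal.

(** * Segments of orbits between visits to a clopen set *)

Section First.
Variables (X : topologicalType) (P : nat -> X -> bool).
Hypothesis P_lc : forall k, lc (P k).
Hypothesis P_ex : forall x, exists k, P k x.

Definition first x := ex_minn (P_ex x).

Lemma first_spec x : P (first x) x.
Proof. by rewrite /first; case: ex_minnP. Qed.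

Lemma first_min j x : (j < first x)%N -> ~~ P j x.
Proof.
rewrite /first; case: ex_minnP => k Pk kmin jk; apply/negP => /kmin.
by rewrite leqNgt jk.
Qed.

Lemma first_eq k x : P k x -> (forall j, (j < k)%N -> ~~ P j x) -> first x = k.
Proof.
move=> Pk kmin; have := first_spec x; case: (ltngtP (first x) k) => // H.
  by rewrite (negbTE (kmin _ H)).
by move: (first_min H); rewrite Pk.
Qed.

Lemma first_lc : lc first.
Proof.
move=> x; have := lc_map (iota 0 (first x).+1) P_lc x.
apply: filterS => z Hz.
have PE j : (j <= first x)%N -> P j z = P j x.
  move=> jx; have := congr1 (fun s => nth false s j) Hz.
  by rewrite !(nth_map 0%N) ?size_iota// nth_iota.
apply: first_eq; first by rewrite PE// first_spec.
by move=> j jx; rewrite PE ?first_min// ltnW.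
Qed.

End First.

Section Segments.
Variables (X : topologicalType) (e : bits X) (a : homeo X X) (E : pred X).
Hypothesis mina : minimal a.
Hypothesis E_lc : lc E.
Hypothesis E_ne : exists x, E x.
Local Notation a' := (hinv a).

Lemma back_ex x : exists k, E (iter k a' x).
Proof.
by have [N HN] := orbit_hits_bounded e mina E_lc E_ne; have [_ [k _ Ek]] := HN x; exists k.
Qed.

Lemma forth_ex x : exists k, E (iter k.+1 a x).
Proof.
have [N HN] := orbit_hits_bounded e mina E_lc E_ne.
by have [[k _ Ek] _] := HN (a x); exists k; rewrite iterSr.
Qed.

(** [bt] vanishes on [E], while [rt] is at least 1: a segment has as many points as the return time
    of its first point. *)
Definition bt x := first (P := fun k x => E (iter k a' x)) back_ex x.
Definition rt x := (first (P := fun k x => E (iter k.+1 a x)) forth_ex x).+1.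
Definition base x := iter (bt x) a' x.

Lemma bt_lc : lc bt.
Proof.
apply: first_lc => k; apply: lc_precomp E_lc; apply: iter_cont; exact: hinv_cont.
Qed.

Lemma rt_lc : lc rt.
Proof.
apply: (lc_comp S); apply: first_lc => k.
by apply: (lc_precomp (u := iter k.+1 a)) E_lc; apply: iter_cont; exact: hfun_cont.
Qed.

Lemma base_cont : continuous base.
Proof.
apply: continuous_local => x; exists (iter (bt x) a').
  by apply: iter_cont; exact: hinv_cont.
by have := bt_lc x; apply: filterS => z; rewrite /base => ->.
Qed.

Lemma E_base x : E (base x).
Proof. exact: (first_spec back_ex x). Qed.

Lemma bt_min j x : (j < bt x)%N -> ~~ E (iter j a' x).
Proof. exact: (first_min (P_ex := back_ex)). Qed.

Lemma E_rt x : E (iter (rt x) a x).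
Proof. exact: (first_spec forth_ex x). Qed.

Lemma rt_min j x : (0 < j < rt x)%N -> ~~ E (iter j a x).
Proof. by case: j => // j; exact: (first_min (P_ex := forth_ex)). Qed.

Lemma iter_base x : iter (bt x) a (base x) = x.
Proof. exact: iter_back. Qed.

Lemma bt_lt_rt x : (bt x < rt (base x))%N.
Proof.
rewrite ltnNge; apply/negP => H; have := E_rt (base x).
rewrite /base iter_back_sub//; apply/negP/bt_min.
by rewrite -subn_gt0 subKn.
Qed.

Lemma bt_eq b i : E b -> (i < rt b)%N -> bt (iter i a b) = i.
Proof.
move=> Eb ib; apply: first_eq; first by rewrite back_iter.
by move=> j ji; rewrite back_iter_sub ?(ltnW ji)//; apply: rt_min; lia.
Qed.

Lemma base_eq b i : E b -> (i < rt b)%N -> base (iter i a b) = b.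
Proof. by move=> Eb ib; rewrite /base bt_eq// back_iter. Qed.

Definition seg_cls x := [seq iter i a (base x) | i <- iota 0 (rt (base x))].

Lemma mem_seg_cls x y : (y \in seg_cls x) = (base y == base x).
Proof.
apply/mapP/eqP => [[i]|yx].
  by rewrite mem_iota add0n /= => ix ->; rewrite base_eq// E_base.
exists (bt y); last by rewrite -yx iter_base.
by rewrite mem_iota /= -yx bt_lt_rt.
Qed.

Definition seg : fcr X.
Proof.
refine (@Fcr X seg_cls _ _ _ _).
- by move=> x; rewrite mem_seg_cls.
- by move=> x y; rewrite mem_seg_cls => /eqP yx; rewrite /seg_cls yx.
- move=> x; rewrite map_inj_in_uniq ?iota_uniq// => i j.
  rewrite !mem_iota !add0n /= => ix jx ij.
  by rewrite -(bt_eq (E_base x) ix) ij bt_eq// E_base.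
- move=> x; exists (rt (base x)), (fun i => iter i a \o iter (bt x) a'); split.
    move=> i; apply: continuous_compose; apply: iter_cont; [exact: hinv_cont|exact: hfun_cont].
  have := lc_precomp base_cont rt_lc x; have := bt_lc x.
  apply: filterS2 => z bz rz; have {}rz : rt (base z) = rt (base x) by exact: rz.
  by rewrite /seg_cls rz {1}/base bz.
Defined.

Lemma mem_seg x y : (y \in seg x) = (base y == base x).
Proof. exact: mem_seg_cls. Qed.

Lemma base_id x : E x -> base x = x.
Proof. by move=> Ex; rewrite -[in LHS](_ : iter 0 a x = x)// base_eq. Qed.

Lemma bt_E x : E x -> bt x = 0%N.
Proof. by move=> Ex; rewrite -[in LHS](_ : iter 0 a x = x)// bt_eq. Qed.

Lemma bt_next x : ~~ E (a x) -> bt (a x) = (bt x).+1 /\ base (a x) = base x.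
Proof.
move=> nE; have H : ((bt x).+1 < rt (base x))%N.
  rewrite ltn_neqAle bt_lt_rt andbT; apply: contra nE => /eqP H.
  by have := E_rt (base x); rewrite -H /= iter_base.
have Eax : a x = iter (bt x).+1 a (base x) by rewrite /= iter_base.
by rewrite Eax bt_eq ?E_base// base_eq ?E_base.
Qed.

Lemma rt_last x : E (a x) -> rt (base x) = (bt x).+1.
Proof.
move=> Ea; apply/eqP; rewrite eqn_leq bt_lt_rt andbT leqNgt; apply/negP => H.
have := @rt_min (bt x).+1 (base x); rewrite H /= iter_base Ea => /(_ erefl).
by [].
Qed.

Lemma seg_disp x y : y \in seg x -> y = iterz a ((bt y)%:Z - (bt x)%:Z) x.
Proof.
rewrite mem_seg => /eqP yx; rewrite iterzD iterzN -/(base x) -yx.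
by rewrite -[LHS]iter_base.
Qed.

Lemma seg_tfg (s : homeo X X) : (forall x, s x \in seg x) -> top_full_group a s.
Proof.
move=> sx; exists (fun x => (bt (s x))%:Z - (bt x)%:Z).
  apply: (lc_comp2 (fun m n : nat => m%:Z - n%:Z)); last exact: bt_lc.
  by apply: lc_precomp bt_lc; exact: hfun_cont.
by move=> x; apply: seg_disp.
Qed.

Lemma csum_seg f x : csum seg f x = \sum_(0 <= i < rt (base x)) f (iter i a (base x)).
Proof. by rewrite /csum /= /seg_cls big_map /index_iota subn0. Qed.

(** The primitive is the sum of [f] along the segment up to and including the point. At the start of
    a segment the preceding value is a full segment sum, hence zero. *)
Lemma null_cobound f : lc f -> null seg f -> cobound a f.
Proof.
move=> lf nf; exists (fun x => \sum_(0 <= i < (bt x).+1) f (iter i a (base x))).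
  apply: lc_eqlocal => x; exists (fun z => \sum_(0 <= i < (bt x).+1) f (iter i a (base z))).
    elim: (bt x).+1 => [|n IH].
      by apply: lc_eqlocal => z; exists (fun=> 0); [exact: lc_cst|near=> w; rewrite big_geq].
    apply: lc_eqlocal => z.
    exists (fun z => \sum_(0 <= i < n) f (iter i a (base z)) + f (iter n a (base z))).
      have ca : continuous (iter n a) by apply: iter_cont; exact: hfun_cont.
      exact: (lc_comp2 +%R IH (lc_precomp base_cont (lc_precomp ca lf))).
    by near=> w; rewrite big_nat_recr.
  by have := bt_lc x; apply: filterS => z ->.
move=> x; have [Ex|nEx] := boolP (E x).
  rewrite (bt_E Ex) (base_id Ex) big_nat1 -rt_last ?hinvK//.
  by rewrite -csum_seg nf subr0.
have Eax : x = a (a' x) by rewrite hinvK.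
rewrite {1}Eax in nEx; have [b1 b2] := bt_next nEx.
move: b1 b2; rewrite -Eax => b1 b2.
by rewrite b1 b2 big_nat_recr //= iter_base hinvK addrC addrK.
Unshelve. all: by end_near. Qed.

(** A segment sum telescopes to the difference of [g (a' _)] at two consecutive visits to [E]. *)
Lemma cobound_null f g v : (forall x, f x = g x - g (a' x)) ->
  (forall x, E x -> g (a' x) = v) -> null seg f.
Proof.
move=> fg gv x; rewrite csum_seg.
have tel n b : \sum_(0 <= i < n) f (iter i a b) = g (a' (iter n a b)) - g (a' b).
  elim: n => [|n IH]; first by rewrite big_geq// subrr.
  by rewrite big_nat_recr //= IH fg hfunK; lia.
by rewrite tel !gv ?subrr ?E_base ?E_rt.
Qed.

End Segments.

Lemma base_base (X : topologicalType) (e : bits X) (a : homeo X X) (E E' : pred X)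
    (ma : minimal a) (lE : lc E) (neE : exists x, E x) (lE' : lc E') (neE' : exists x, E' x) :
  (forall x, E' x -> E x) -> forall x,
  base e ma lE' neE' x = base e ma lE' neE' (base e ma lE neE x).
Proof.
move=> EE' x; set b := base e ma lE neE x.
suff H : bt e ma lE' neE' x = (bt e ma lE' neE' b + bt e ma lE neE x)%N.
  by rewrite /base H iterD.
apply: first_eq; first by rewrite iterD; exact: (E_base e ma lE' neE' b).
move=> j jlt; have [jx|xj] := ltnP j (bt e ma lE neE x).
  by apply: contra (bt_min jx); exact: EE'.
rewrite -(subnK xj) iterD.
by apply: (@bt_min _ e a E' ma lE' neE'); rewrite ltn_subLR// addnC.
Qed.

(** * Segments over shrinking cells around a base point *)

Section Cells.
Variables (X : topologicalType) (e : bits X) (a : homeo X X) (x0 : X).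
Hypothesis mina : minimal a.
Local Notation a' := (hinv a).

Definition Ecell p : pred X := fun x => cell e p x == cell e p x0.

Lemma Ecell_lc p : lc (Ecell p).
Proof. exact: (lc_comp (fun n => n == cell e p x0) (cell_lc e p)). Qed.

Lemma Ecell_ne p : exists x, Ecell p x.
Proof. by exists x0; rewrite /Ecell. Qed.

Definition Rseg p := seg e mina (Ecell_lc p) (Ecell_ne p).

Lemma Rseg_mono p : subfcr (Rseg p) (Rseg p.+1).
Proof.
move=> x y; rewrite !mem_seg => /eqP yx; apply/eqP.
have sub z : Ecell p.+1 z -> Ecell p z.
  by move=> /eqP H; apply/eqP; exact: (@cellW _ e p p.+1).
rewrite (base_base e mina (Ecell_lc p) (Ecell_ne p) _ _ sub y).
by rewrite (base_base e mina (Ecell_lc p) (Ecell_ne p) _ _ sub x) yx.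
Qed.

Lemma cobound_Bnull f : lc f -> (cobound a f <-> Bnull Rseg f).
Proof.
move=> lf; split => [[g lg fg]|[p /(null_cobound lf)//]].
have lga : lc (g \o a') by apply: lc_precomp lg; exact: hinv_cont.
have [p Hp] := lc_cell e lga.
exists p; apply: (@cobound_null _ e a _ mina (Ecell_lc p) (Ecell_ne p) f g (g (a' x0)) fg).
by move=> x /eqP; exact: Hp.
Qed.

(** [x0] lies in every cell and so starts its segment; if that segment contained [a' x0], the orbit
    would close up. *)
Lemma Rseg_cut p : a' x0 \notin Rseg p x0.
Proof.
rewrite mem_seg [X in _ == X]base_id ?/Ecell//; apply/negP => /eqP b0.
have := @iter_base _ e a _ mina (Ecell_lc p) (Ecell_ne p) (a' x0).
rewrite b0 => /(congr1 a); rewrite hinvK -iterS.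
exact: (aperiodic e mina).
Qed.

(** A new segment starts only in the cell of [x0], and points near [a x] avoid it at a fine enough
    level. *)
Lemma Rseg_next x : a x <> x0 -> exists p, \forall z \near x, a z \in Rseg p z.
Proof.
move=> ax.
have [p cp] : exists p, cell e p (a x) <> cell e p x0.
  by apply: contrapT => /forallNP H; apply/ax/(cell_sep (e := e)) => p; exact: contrapT.
exists p; have := lc_precomp (@hfun_cont _ _ a) (cell_lc e p) x.
apply: filterS => z /= cz; rewrite mem_seg; apply/eqP.
have [] // := @bt_next _ e a _ mina (Ecell_lc p) (Ecell_ne p) z.
by rewrite /Ecell cz; apply/eqP.
Qed.

End Cells.

(** * Coboundaries *)

Section Cobound.
Variables (X : topologicalType) (a : homeo X X).

Lemma cobound_lc f : cobound a f -> lc f.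
Proof.
move=> [g lg fg]; have lga : lc (g \o hinv a) by apply: lc_precomp lg; exact: hinv_cont.
have H := lc_comp2 (fun m n : int => m - n) lg lga.
by move=> x; have := H x; apply: filterS => z /=; rewrite !fg.
Qed.

Lemma cobound_ext f g : f =1 g -> cobound a f -> cobound a g.
Proof. by move=> fg [h lh fh]; exists h => // x; rewrite -fg. Qed.

Lemma coboundB f g : cobound a f -> cobound a g -> cobound a (fun x => f x - g x).
Proof.
move=> [h lh fh] [k lk gk]; exists (fun x => h x - k x).
  exact: (lc_comp2 (fun m n : int => m - n) lh lk).
by move=> x; rewrite fh gk; lia.
Qed.

Lemma cobound0 : cobound a (fun=> 0).
Proof. by exists (fun=> 0); [exact: lc_cst|move=> x; rewrite subrr]. Qed.

Lemma coboundN f : cobound a f -> cobound a (fun x => - f x).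
Proof. by move=> /(coboundB cobound0); apply: cobound_ext => x; rewrite sub0r. Qed.

Lemma coboundD f g : cobound a f -> cobound a g -> cobound a (fun x => f x + g x).
Proof. by move=> cf /coboundN /(coboundB cf); apply: cobound_ext => x; rewrite opprK. Qed.

Lemma cobound_sum (s : seq nat) (f : nat -> X -> int) :
  (forall i, cobound a (f i)) -> cobound a (fun x => \sum_(i <- s) f i x).
Proof.
move=> cf; elim: s => [|i s IH].
  by apply: cobound_ext cobound0 => x; rewrite big_nil.
by apply: cobound_ext (coboundD (cf i) IH) => x; rewrite big_cons.
Qed.

Lemma cobound_iterz (u : X -> int) k : lc u ->
  cobound a (fun x => u (iterz a k x) - u x).
Proof.
move=> lu; elim/int_ind: k u lu => [|n IH|n IH] u lu.
- by apply: cobound_ext cobound0 => x; rewrite subrr.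
- have lua : lc (u \o a) by apply: lc_precomp lu; exact: hfun_cont.
  have c1 : cobound a (fun x => u (a x) - u x) by exists (u \o a) => // x /=; rewrite hinvK.
  by apply: cobound_ext (coboundD (IH _ lua) c1) => x /=; lia.
- have lua : lc (u \o hinv a) by apply: lc_precomp lu; exact: hinv_cont.
  have c1 : cobound a (fun x => u x - u (hinv a x)) by exists u.
  apply: cobound_ext (coboundB (IH _ lua) c1) => x /=.
  rewrite iterzN.
  by lia.
Qed.

(* The displacement [nu] is only required where [f \o g] does not vanish, so that
   a homeomorphism with one discontinuity in its cocycle is also covered. *)
Lemma cobound_transfer (e : bits X) (g : homeo X X) (nu : X -> int) (f : X -> int) :
  lc nu -> lc f -> (forall x, f (g x) != 0 -> g x = iterz a (nu x) x) ->
  cobound a (fun x => f (g x) - f x).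
Proof.
move=> lnu lf Hg.
have lfg : lc (f \o g) by apply: lc_precomp lf; exact: hfun_cont.
have [N HN] := lc_bounded e (lc_comp absz lnu).
pose j (i : nat) : int := i%:Z - N%:Z.
(* The pieces of [f (g _)] by displacement sum to [f (g _)], and their translates by [- j i] sum to
   [f], since only the preimage of a point under [g] contributes. *)
pose w i x : int := if nu x == j i then f (g x) else 0.
have lw i : lc (w i).
  exact: (lc_comp2 (fun m n => if m == j i then n else 0) lnu lfg).
pose s := iota 0 (N + N).
have js x : exists2 i, i \in s & nu x = j i.
  exists (absz (nu x + N%:Z)); last by rewrite /j; have := HN x; rewrite /=; lia.
  by rewrite mem_iota; have := HN x; rewrite /=; lia.
have jinj i i' : j i = j i' -> i = i' by rewrite /j; lia.
have us : uniq s by exact: iota_uniq.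
have E1 x : \sum_(i <- s) w i x = f (g x).
  have [i is_ ni] := js x; rewrite (bigD1_seq i)//= big1 ?addr0 /w ?ni ?eqxx//.
  by move=> i' ii'; case: eqP => // /jinj E; rewrite E eqxx in ii'.
have E2 x : \sum_(i <- s) w i (iterz a (- j i) x) = f x.
  have wP i : w i (iterz a (- j i) x) <> 0 -> g (iterz a (- j i) x) = x /\ nu (iterz a (- j i) x) = j i.
    rewrite /w; case: eqP => // ni /eqP /Hg; rewrite ni iterzVK => E; by split.
  have [fx0|fx] := eqVneq (f x) 0.
    rewrite fx0 big1// => i _; apply: contrapT => /[dup] wi /wP [gx _].
    by apply: wi; rewrite /w gx fx0; case: ifP.
  pose v := hinv g x; have gv : g v = x by exact: hinvK.
  have vx : x = iterz a (nu v) v by rewrite -{1}gv; apply: Hg; rewrite gv.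
  have [i is_ ni] := js v.
  have iv : iterz a (- j i) x = v by rewrite {1}vx ni iterzK.
  rewrite (bigD1_seq i)//= big1 ?addr0 /w ?iv ?ni ?eqxx ?gv// => i' ii'.
  apply: contrapT => /wP [gx ni'].
  have vv : iterz a (- j i') x = v by rewrite /v -[in RHS]gx hfunK.
  by move: ii'; rewrite vv ni in ni'; rewrite (jinj _ _ ni') eqxx.
have := cobound_sum s (fun i => coboundN (cobound_iterz (- j i) (lw i))).
apply: cobound_ext => x; rewrite -E1 -E2 -sumrB; apply: eq_bigr => i _.
by rewrite opprB.
Qed.

Lemma cobound_tfg (e : bits X) (s : homeo X X) (f : X -> int) : top_full_group a s -> lc f ->
  cobound a (fun x => f (s x) - f x).
Proof. by move=> [n ln sn] lf; apply: cobound_transfer ln lf _ => // x _; exact: sn. Qed.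

Lemma K0pos_cobound f g : K0pos a f -> cobound a (fun x => g x - f x) -> K0pos a g.
Proof.
move=> [p [lp p0 cp]] cg; exists p; split => //.
by apply: cobound_ext (coboundD cg cp) => x; lia.
Qed.

End Cobound.

(** * Realising and adjusting classes by clopen sets *)

Section MinimalCobound.
Variables (X : topologicalType) (e : bits X) (a : homeo X X).
Hypothesis mina : minimal a.

Lemma cobound_ge0 f : cobound a f -> (forall x, 0 <= f x) -> forall x, f x = 0.
Proof.
move=> cf f0 x; have [p np] := (cobound_Bnull e x mina (cobound_lc cf)).1 cf.
have := np x; rewrite /csum (bigD1_seq x (cls_self _ x) (cls_uniq _ x)) => H.
apply/eqP; rewrite eq_le f0 andbT -H lerDl; exact: sumr_ge0.
Qed.

Lemma mem_take_filter (A : eqType) (W : pred A) (l : seq A) n x : uniq l -> x \in l ->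
  (x \in take n (seq.filter W l)) = W x && (count W (take (index x l) l) < n)%N.
Proof.
elim: l n => [//|y l IH] n /= /andP[yl ul]; rewrite inE => /orP[/eqP xy|xl].
  subst y; rewrite eqxx /=; case: (W x); last first.
    by apply/negP => /mem_take; rewrite mem_filter (negbTE yl) andbF.
  by case: n => // n; rewrite /= inE eqxx.
have yx : (y == x) = false by apply/eqP => E; rewrite E xl in yl.
rewrite yx /=; case: (W y) => /=; last by rewrite add0n IH.
case: n => [|n]; first by rewrite in_nil andbF.
by rewrite /= inE eq_sym yx /= IH// add1n ltnS.
Qed.

(** Since [q] is nonnegative, in each class of a suitable segment relation the sum of [p] is at most
    the number of points of [W]; [V] takes that many of them, the first in the listing. *)
Lemma cobound_subset (W : pred X) (p q : X -> int) : lc W -> lc p -> lc q ->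
  (forall x, 0 <= p x) -> (forall x, 0 <= q x) ->
  cobound a (fun x => p x + q x - (W x)%:R) ->
  exists V : pred X, [/\ lc V, forall x, V x -> W x & cobound a (fun x => (V x)%:R - p x)].
Proof.
move=> lW lp lq p0 q0 cpq.
have [x0|noX] := pselect (exists _ : X, True); last first.
  exists W; split => //; apply: cobound_ext (cobound0 a) => x; case: noX; by exists x.
case: x0 => x0 _.
have [T nr Tcob] : exists2 T : fcr X, null T (fun x => p x + q x - (W x)%:R) &
    forall f : X -> int, lc f -> null T f -> cobound a f.
  have [r nr] := (cobound_Bnull e x0 mina (cobound_lc cpq)).1 cpq.
  by exists (Rseg e x0 mina r) => // f lf; exact: null_cobound.
pose n x := absz (csum T p x).
have sum0 (f : X -> int) x : (forall y, 0 <= f y) -> 0 <= csum T f x.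
  by move=> f0; apply: sumr_ge0.
have nE x : (n x)%:Z = csum T p x by rewrite /n gez0_abs// sum0.
have nW x : (n x <= count W (T x))%N.
  have := nr x; rewrite /csum sumrB big_split /= -/(csum T p x) -/(csum T q x).
  by rewrite sum_indic natz -nE; have := sum0 q x q0; lia.
pose V : pred X := fun x => x \in take (n x) (seq.filter W (T x)).
have VE x : V x = W x && (count id (take (pos T x) (map W (T x))) < n x)%N.
  by rewrite /V mem_take_filter ?cls_uniq ?cls_self// -map_take count_map.
have lV : lc V.
  have ln : lc n by apply: (lc_comp absz); exact: csum_lc.
  have lm := lc_cls_map T lW.
  have l1 := lc_comp2 (fun i s => count id (take i s)) (pos_lc e T) lm.
  have l2 := lc_comp2 (fun i m => (i < m)%N) l1 ln.
  have l3 := lc_comp2 andb lW l2.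
  by move=> x; have := l3 x; apply: filterS => z; rewrite !VE.
exists V; split => //; first by move=> x; rewrite VE => /andP[].
have lVp : lc (fun x => (V x)%:R - p x).
  exact: (lc_comp2 (fun (b : bool) (m : int) => b%:R - m) lV lp).
apply: Tcob => // x.
rewrite /csum sumrB -/(csum T p x) -nE sum_indic; apply/eqP; rewrite subr_eq0.
apply/eqP; rewrite natz; congr Posz; set s := take (n x) (seq.filter W (T x)).
have -> : count V (T x) = count (mem s) (T x).
  apply: eq_in_count => y yx; rewrite /V /n (csum_cls _ yx) (cls_eq yx) //.
have us : uniq (seq.filter W (T x)) by rewrite filter_uniq// cls_uniq.
rewrite -size_filter; have /subseq_uniqP <- // : subseq s (T x).
- by apply: subseq_trans (take_subseq _ _) (filter_subseq _ _).
- by rewrite size_takel// size_filter.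
- exact: cls_uniq.
Qed.

(** A small clopen neighbourhood of [y] replaces one of its translates lying in [V] and away from
    [y']; this changes the indicator by a coboundary. *)
Lemma swap_into (V W : pred X) (y y' : X) : lc V -> lc W -> (forall x, V x -> W x) ->
  W y -> ~~ V y -> (exists v, V v) -> y <> y' ->
  exists V' : pred X, [/\ lc V', forall x, V' x -> W x,
    cobound a (fun x => (V' x)%:R - (V x)%:R), V' y & V' y' = V y'].
Proof.
move=> lV lW VW Wy nVy [v0 Vv0] yy'.
have sepP x z : x <> z -> exists k, cell e k x <> cell e k z.
  by move=> xz; apply: contrapT => /forallNP H; apply/xz/(cell_sep (e := e)) => k; exact: contrapT.
(* Perfectness supplies a point of [V] other than [y']; a cell around [y'] can then be removed from
   the target [V0] without emptying it. *)
have [v Vv /sepP [K cK]] : exists2 v, V v & v <> y'.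
  have [E|] := pselect (v0 = y'); last by exists v0.
  have : nbhs v0 [set z | V z] by have := lV v0; apply: filterS => z /= ->.
  by move=> /(bits_perfect e) [v Vv vv0]; exists v => //; rewrite -E.
pose V0 : pred X := fun x => V x && (cell e K x != cell e K y').
have lV0 : lc V0.
  exact: (lc_comp2 (fun b c => b && (c != cell e K y')) lV (cell_lc e K)).
have [|i Vi] := orbit_hits mina lV0 _ y; first by exists v; rewrite /V0 Vv; apply/eqP.
have lVi : lc (V0 \o iterz a i) by apply: lc_precomp lV0; exact: iterz_cont.
have [l1 H1] := lc_cell e (lc_pair (lc_pair lW lV) lVi).
have [l2 H2] := sepP _ _ yy'.
pose l := maxn l1 l2; pose A : pred X := fun z => cell e l z == cell e l y.
have AP z : A z -> [/\ W z, ~~ V z & V0 (iterz a i z)].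
  move=> /eqP /(cellW (leq_maxl l1 l2)) /H1 [Wz Vz V0z].
  by rewrite Wz Vz; split => //; move: V0z => /= ->.
have nAy' : A y' = false.
  by apply/eqP => /(cellW (leq_maxr l1 l2)) /esym.
have lA : lc A by exact: (lc_comp (fun c => c == cell e l y) (cell_lc e l)).
have lAi : lc (A \o iterz a (- i)) by apply: lc_precomp lA; exact: iterz_cont.
have BP z : A (iterz a (- i) z) -> V z /\ V0 z.
  move=> /AP [_ _]; rewrite iterzVK => V0z; split => //; by case/andP: V0z.
pose V' : pred X := fun z => A z || (V z && ~~ A (iterz a (- i) z)).
exists V'; split.
- exact: (lc_comp2 orb lA (lc_comp2 (fun b c => b && ~~ c) lV lAi)).
- by move=> x /orP[/AP []//|/andP[/VW]].
- have lAn : lc (fun x => (A x)%:R : int) by exact: (lc_comp (fun b : bool => b%:R : int) lA).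
  apply: cobound_ext (coboundN (cobound_iterz a (- i) lAn)) => z /=.
  rewrite /V'; case Az: (A z) => /=.
    have [_ nVz _] := AP z Az; rewrite (negbTE nVz).
    by case Bz: (A _); [move: nVz; have [-> _] := BP _ Bz|].
  by case Bz: (A _); [have [-> _] := BP _ Bz|case: (V z)].
- by rewrite /V' /A eqxx.
- rewrite /V' nAy' /=; case Bz: (A _); last by rewrite andbT.
  by have [_] := BP _ Bz; rewrite /V0 eqxx andbF.
Qed.

End MinimalCobound.

(** * Homeomorphisms acting trivially on [K^0] *)

Section Closure.
Variables (R : realType) (X : pseudoMetricType R) (e : bits X) (a : homeo X X).
Hypothesis mina : minimal a.

(** An element of the topological full group close enough to [g] moves a given [f] exactly as [g]
    does. Conversely, trivial action on indicators of cells allows the colours [cell e k (g _)] and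
    [cell e k] to be matched inside the classes of one segment relation. *)
Lemma closure_tfgP (g : homeo X X) :
  in_closure_tfg a g <-> forall f : X -> int, lc f -> cobound a (fun x => f (g x) - f x).
Proof.
split => [cg f lf|tg r r0].
  have [k Hk] := lc_cell e lf; have [r r0 Hr] := ball_cell e k.
  have [s ts sg] := cg r r0.
  by apply: cobound_ext (cobound_tfg e ts lf) => x; rewrite (Hk _ _ (Hr _ _ (sg x))).
have [x0|noX] := pselect (exists _ : X, True); last first.
  have noX' (x : X) : False by apply: noX; exists x.
  by exists g => [|x]; [exists (fun=> 0) => x|]; case: (noX' x).
case: x0 => x0 _; have [k Hk] := cell_ball e r0.
pose T p := Rseg e x0 mina p.
pose D i y : int := (cell e k (g y) == i)%:R - (cell e k y == i)%:R.
have lcg : lc (fun y => cell e k (g y)).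
  exact: (lc_precomp (@hfun_cont _ _ g) (cell_lc e k)).
have nD i : exists p, null (T p) (D i).
  have lu : lc (fun y => (cell e k y == i)%:R : int).
    exact: (lc_comp (fun n => (n == i)%:R : int) (cell_lc e k)).
  have := tg _ lu => cD; exact: (cobound_Bnull e x0 mina (cobound_lc cD)).1 cD.
have [||p Hp] := @compact_uniform X e (fun p x => null (T p) (D (cell e k x))).
- move=> m n x mn; apply: null_mono; apply: fcr_monoW mn => q; exact: Rseg_mono.
- move=> x; have [p np] := nD (cell e k x); exists p.
  by have := cell_lc e k x; apply: filterS => z ->.
have [||i|s Hs] := @fcr_match X e (T p) (fun y => cell e k (g y)) (cell e k).
- exact: lcg.
- exact: cell_lc.
- have [[x <-]|nx] := pselect (exists x, cell e k x = i); first exact: Hp.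
  have nx' x : (cell e k x == i) = false by apply/eqP => E; apply: nx; exists x.
  by move=> x; rewrite /csum big1// => y _; rewrite !nx' subrr.
exists s.
  by apply: (@seg_tfg X e a _ mina (Ecell_lc e x0 p) (Ecell_ne e x0 p)) => x; have [] := Hs x.
by move=> x; apply: Hk; have [_ ->] := Hs x.
Qed.

End Closure.

(** * Lifting an isomorphism of [K^0] to a homeomorphism *)

Definition indic (X : Type) (U : X -> bool) (x : X) : int := (U x)%:R.

Lemma indic_lc (X : topologicalType) (U : X -> bool) : lc U -> lc (indic U).
Proof. exact: (lc_comp (fun b : bool => b%:R : int)). Qed.

(* A symmetric presentation of a unital order isomorphism as a relation between
   functions; it contains the coboundaries of both sides. *)
Record corr (X Y : topologicalType) (a : homeo X X) (b : homeo Y Y)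
    (M : (X -> int) -> (Y -> int) -> Prop) : Prop := Corr {
  corr_lc : forall f g, M f g -> lc f /\ lc g;
  corr_sub : forall f g f' g', M f g -> M f' g' ->
    M (fun x => f x - f' x) (fun y => g y - g' y);
  corr_cob : forall f g, M f g -> (cobound a f <-> cobound b g);
  corr_l : forall f, lc f -> exists g, M f g;
  corr_r : forall g, lc g -> exists f, M f g;
  corr_pos : forall f g, M f g -> (K0pos a f <-> K0pos b g);
  corr_one : M (fun=> 1) (fun=> 1);
  corr_closed : forall f g f' g', M f g -> cobound a (fun x => f' x - f x) ->
    cobound b (fun y => g' y - g y) -> M f' g' }.

Lemma corr_sym (X Y : topologicalType) (a : homeo X X) (b : homeo Y Y) M :
  corr a b M -> corr b a (fun g f => M f g).
Proof.
case=> clc csub ccob cl cr cpos cone cclosed; split => //.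
- by move=> f g /clc [].
- by move=> f g f' g'; exact: csub.
- by move=> f g /ccob ->.
- by move=> f g /cpos ->.
- by move=> f g f' g' H c1 c2; exact: cclosed H c2 c1.
Qed.

Lemma corr_of_iso (X Y : topologicalType) (a : homeo X X) (b : homeo Y Y) :
  K0_unital_order_iso a b -> exists M, corr a b M.
Proof.
move=> [Phi [[Plc Pcob] Padd Psurj Ppos Pone]].
exists (fun f g => [/\ lc f, lc g & cobound b (fun y => Phi f y - g y)]).
have lcD (Z : topologicalType) (f g : Z -> int) : lc f -> lc g -> lc (fun x => f x - g x).
  exact: (lc_comp2 (fun m n : int => m - n)).
have Psub (f f' : X -> int) : lc f -> lc f' ->
    cobound b (fun y => Phi (fun x => f x - f' x) y - (Phi f y - Phi f' y)).
  move=> lf lf'; have := Padd _ _ (lcD _ _ _ lf lf') lf'.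
  have -> : (fun x => f x - f' x + f' x) = f by apply: funext => x; rewrite subrK.
  by move=> /coboundN; apply: cobound_ext => y; lia.
split.
- by move=> f g [].
- move=> f g f' g' [lf lg c] [lf' lg' c']; split; [exact: lcD|exact: lcD|].
  by apply: cobound_ext (coboundD (Psub _ _ lf lf') (coboundB c c')) => y; lia.
- move=> f g [lf lg c]; rewrite (Pcob f lf); split => H.
    by apply: cobound_ext (coboundB H c) => y; lia.
  by apply: cobound_ext (coboundD H c) => y; lia.
- by move=> f lf; exists (Phi f); split => //; [exact: Plc|apply: cobound_ext (cobound0 b) => y; rewrite subrr].
- by move=> g lg; have [f lf c] := Psurj g lg; exists f.
- move=> f g [lf lg c]; rewrite (Ppos f lf); split => H; apply: K0pos_cobound H _ => //.
  by apply: cobound_ext (coboundN c) => y; lia.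
- by split; [exact: lc_cst|exact: lc_cst|].
- move=> f g f' g' [lf lg c] cf cg.
  have ef : f' = (fun x => f' x - f x + f x) by apply: funext => x; rewrite subrK.
  have eg : g' = (fun x => g' x - g x + g x) by apply: funext => x; rewrite subrK.
  have lf' : lc f' by rewrite ef; exact: (lc_comp2 +%R (cobound_lc cf) lf).
  have lg' : lc g' by rewrite eg; exact: (lc_comp2 +%R (cobound_lc cg) lg).
  split => //; have := Psub _ _ lf' lf => c1.
  have c2 := (Pcob _ (lcD _ _ _ lf' lf)).1 cf.
  by apply: cobound_ext (coboundB (coboundD c (coboundB c2 c1)) cg) => y; lia.
Qed.

Section CorrTheory.
Variables (X Y : topologicalType) (eX : bits X) (eY : bits Y).
Variables (a : homeo X X) (b : homeo Y Y).
Hypothesis mina : minimal a.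
Hypothesis minb : minimal b.
Variable M : (X -> int) -> (Y -> int) -> Prop.
Hypothesis cM : corr a b M.

Lemma corr_ext f g f' g' : f =1 f' -> g =1 g' -> M f g -> M f' g'.
Proof. by move=> /funext <- /funext <-. Qed.

Lemma corr_zero : M (fun=> 0) (fun=> 0).
Proof.
by have := corr_sub cM (corr_one cM) (corr_one cM); apply: corr_ext => x; rewrite subrr.
Qed.

Lemma corr_add f g f' g' : M f g -> M f' g' ->
  M (fun x => f x + f' x) (fun y => g y + g' y).
Proof.
move=> H H'; have := corr_sub cM H (corr_sub cM corr_zero H').
by apply: corr_ext => x; lia.
Qed.

Lemma corr_scale (k : int) f g : M f g -> M (fun x => k * f x) (fun y => k * g y).
Proof.
move=> H; elim/int_ind: k => [|n IH|n IH].
- by apply: corr_ext corr_zero => x; rewrite mul0r.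
- by apply: corr_ext (corr_add IH H) => x; rewrite intS mulrDl mul1r addrC.
- by apply: corr_ext (corr_sub cM IH H) => x; rewrite intS opprD mulrDl mulN1r addrC.
Qed.

(** An empty [V] would make [indic U] a nonnegative coboundary, hence zero. *)
Lemma corr_nonempty (U : X -> bool) (V : Y -> bool) : M (indic U) (indic V) ->
  (exists x, U x) -> exists y, V y.
Proof.
move=> MUV [x Ux]; apply: contrapT => /forallNP nV.
have : cobound a (indic U).
  apply/(corr_cob cM MUV); apply: cobound_ext (cobound0 b) => y.
  by rewrite /indic; have /negP/negbTE -> := nV y.
move=> /(cobound_ge0 eX mina) /(_ _ x); rewrite /indic Ux => H.
by have : 1 = 0 :> int by apply: H => z; case: (U z).
Qed.

(** The partners of [indic C] and of its complement in [U] are cohomologous to nonnegative functions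
    whose sum has the class of [indic V], which is the situation of [cobound_subset]. *)
Lemma corr_split (U C : X -> bool) (V : Y -> bool) : M (indic U) (indic V) ->
  lc V -> lc C -> (forall x, C x -> U x) ->
  exists D : Y -> bool, [/\ lc D, forall y, D y -> V y & M (indic C) (indic D)].
Proof.
move=> MUV lV lC CU; have [g Mg] := corr_l cM (indic_lc lC).
have pos0 (f : X -> int) : lc f -> (forall x, 0 <= f x) -> K0pos a f.
  move=> lf f0; exists f; split => //.
  by apply: cobound_ext (cobound0 a) => x; rewrite subrr.
have [|p [lp p0 cp]] := (corr_pos cM Mg).1 _.
  by apply: pos0; [exact: indic_lc|move=> x; rewrite /indic; case: (C x)].
have MUC := corr_sub cM MUV Mg.
have [|q [lq q0 cq]] := (corr_pos cM MUC).1 _.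
  apply: pos0; first by have [] := corr_lc cM MUC.
  by move=> x; rewrite /indic; have := CU x; case: (C x); case: (U x) => // ->.
have [|D [lD DV cD]] := cobound_subset eY minb lV lp lq p0 q0.
  by apply: cobound_ext (coboundN (coboundD cp cq)) => y; rewrite /indic; lia.
exists D; split => //; apply: (corr_closed cM Mg).
  by apply: cobound_ext (cobound0 a) => x; rewrite subrr.
by apply: cobound_ext (coboundB cD cp) => y; rewrite /indic; lia.
Qed.

(** If [D] is wrong at [y], a swap brings [y] into [D], or into the complement of [D] in [V], and
    leaves [y'] alone; two applications settle both marked points. *)
Lemma corr_adjust (U C : X -> bool) (V D : Y -> bool) (x : X) (y y' : Y) :
  M (indic U) (indic V) -> lc V -> (forall x, C x -> U x) ->
  lc D -> (forall y, D y -> V y) -> M (indic C) (indic D) ->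
  U x = V y -> y <> y' ->
  exists D' : Y -> bool, [/\ lc D', forall y, D' y -> V y, M (indic C) (indic D'),
    D' y = C x & D' y' = D y'].
Proof.
move=> MUV lV CU lD DV MCD UV yy'.
have [E|nE] := eqVneq (D y) (C x); first by exists D.
have cob0 (f : X -> int) : cobound a (fun z => f z - f z).
  by apply: cobound_ext (cobound0 a) => z; rewrite subrr.
case Cx: (C x) nE => nE.
  have nD : ~~ D y by move: nE; case: (D y).
  have Vy : V y by rewrite -UV CU.
  have neD : exists v, D v by apply: corr_nonempty MCD _; exists x.
  have [D' [lD' D'V cD' D'y D'y']] := swap_into eY minb lD lV DV Vy nD neD yy'.
  exists D'; split => //.
  by apply: (corr_closed cM MCD); [exact: cob0|].
have Dy : D y by move: nE; case: (D y).
have Vy : V y by exact: DV.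
pose G z := V z && ~~ D z; pose B z := U z && ~~ C z.
have lG : lc G by exact: (lc_comp2 (fun b c => b && ~~ c) lV lD).
have MBG : M (indic B) (indic G).
  apply: corr_ext (corr_sub cM MUV MCD) => z; rewrite /indic /B /G.
    by have := CU z; case: (C z); case: (U z) => // ->.
  by have := DV z; case: (D z); case: (V z) => // ->.
have neG : exists v, G v.
  by apply: corr_nonempty MBG _; exists x; rewrite /B Cx UV Vy.
have GV z : G z -> V z by case/andP.
have nGy : ~~ G y by rewrite /G Dy andbF.
have [G' [lG' G'V cG' G'y G'y']] := swap_into eY minb lG lV GV Vy nGy neG yy'.
exists (fun z => V z && ~~ G' z); split.
- exact: (lc_comp2 (fun b c => b && ~~ c) lV lG').
- by move=> z /andP[].
- apply: (corr_closed cM MCD); first exact: cob0.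
  apply: cobound_ext (coboundN cG') => z; rewrite /indic /G.
  have := G'V z; have := DV z; case: (D z); case: (V z); case: (G' z) => //= H1 H2;
    solve [by have := H1 isT | by have := H2 isT].
- by rewrite G'y andbF.
- by rewrite G'y' /G; have := DV y'; case: (V y'); case: (D y') => // ->.
Qed.

Variables (x0 x1 : X) (y0 y1 : Y).
Hypothesis y01 : y0 <> y1.

Lemma corr_split_pointed (U C : X -> bool) (V : Y -> bool) : M (indic U) (indic V) ->
  lc V -> lc C -> (forall x, C x -> U x) -> U x0 = V y0 -> U x1 = V y1 ->
  exists D : Y -> bool, [/\ lc D, forall y, D y -> V y, M (indic C) (indic D),
    D y0 = C x0 & D y1 = C x1].
Proof.
move=> MUV lV lC CU UV0 UV1.
have [D [lD DV MD]] := corr_split MUV lV lC CU.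
have [D1 [lD1 D1V MD1 D1y _]] := corr_adjust MUV lV CU lD DV MD UV0 y01.
have [|D2 [lD2 D2V MD2 D2y D2y']] := corr_adjust (y' := y0) MUV lV CU lD1 D1V MD1 UV1.
  by move=> /esym.
by exists D2; split => //; rewrite D2y'.
Qed.

Definition pmatch (P : X -> nat) (Q : Y -> nat) :=
  [/\ lc P, lc Q, forall i, M (indic (fun x => P x == i)) (indic (fun y => Q y == i)),
      P x0 = Q y0 & P x1 = Q y1].

Lemma pmatch_refine P Q (C : X -> bool) : pmatch P Q -> lc C ->
  exists D : Y -> bool,
    pmatch (fun x => ((P x).*2 + C x)%N) (fun y => ((Q y).*2 + D y)%N).
Proof.
move=> [lP lQ MPQ P0 P1] lC.
have leq (Z : topologicalType) (f : Z -> nat) i : lc f -> lc (fun z => f z == i).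
  exact: (lc_comp (fun n => n == i)).
have /choice [D HD] : forall i, exists D : Y -> bool, [/\ lc D,
    forall y, D y -> Q y == i, M (indic (fun x => (P x == i) && C x)) (indic D),
    D y0 = (P x0 == i) && C x0 & D y1 = (P x1 == i) && C x1].
  move=> i; apply: (corr_split_pointed (MPQ i)).
  - exact: leq.
  - exact: (lc_comp2 andb (leq _ _ i lP) lC).
  - by move=> x /andP[].
  - by rewrite P0.
  - by rewrite P1.
exists (fun y => D (Q y) y); split.
- exact: (lc_comp2 (fun n (c : bool) => (n.*2 + c)%N) lP lC).
- apply: (lc_comp2 (fun n (c : bool) => (n.*2 + c)%N) lQ).
  apply: lc_eqlocal => y; exists (D (Q y)); first by have [] := HD (Q y).
  by have := lQ y; apply: filterS => z ->.
- move=> n; set i := n./2; have [_ DQ MD _ _] := HD i.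
  have nE m (c : bool) : ((m.*2 + c)%N == n) = (m == i) && (c == odd n).
    apply/eqP/andP => [E|[/eqP -> /eqP ->]].
      by rewrite /i -E half_double_bit odd_double_bit.
    by rewrite addnC odd_double_half.
  case nodd: (odd n).
    apply: corr_ext MD => z; rewrite /indic nE nodd eqb_id//.
    case: eqP => [<-//|nz] /=; case Dz: (D i z) => //.
    by case: nz; apply/eqP/DQ.
  apply: corr_ext (corr_sub cM (MPQ i) MD) => z; rewrite /indic nE nodd eqbF_neg.
    by case: (P z == i); case: (C z).
  case: eqP => [<-|nz] /=; first by case: (D _ z).
  case Dz: (D i z) => //; by case: nz; apply/eqP/DQ.
- by rewrite P0; have [_ _ _ -> _] := HD (Q y0); rewrite P0 eqxx.
- by rewrite P1; have [_ _ _ _ ->] := HD (Q y1); rewrite P1 eqxx.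
Qed.

End CorrTheory.

Lemma pmatch_sym (X Y : topologicalType) (M : (X -> int) -> (Y -> int) -> Prop)
    x0 x1 y0 y1 P Q :
  pmatch M x0 x1 y0 y1 P Q -> pmatch (fun g f => M f g) y0 y1 x0 x1 Q P.
Proof. by case=> lP lQ MPQ P0 P1; split. Qed.

(** Composition with a homeomorphism preserves nonnegative functions and the constant 1, so
    comparing coboundaries already yields a unital order isomorphism. *)
Definition K0_lift (X Y : topologicalType) (a : homeo X X) (b : homeo Y Y)
    (F : homeo X Y) :=
  forall f : X -> int, lc f -> (cobound a f <-> cobound b (f \o hinv F)).

Lemma K0_lift_sym (X Y : topologicalType) (a : homeo X X) (b : homeo Y Y) F :
  K0_lift a b F -> K0_lift b a (hsym F).
Proof.
move=> HF f lf; have lF : lc (f \o F) by exact: lc_precomp (@hfun_cont _ _ F) lf.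
rewrite (_ : f \o hinv (hsym F) = f \o F)//.
rewrite HF//; suff -> : (f \o F) \o hinv F = f by [].
by apply: funext => y /=; rewrite hinvK.
Qed.

(** Stage [k] refines by bit [k] of [X] and copies the refinement to [Y], then does the same with
    bit [k] of [Y]. Colours with corresponding indicators are nonempty together, so the codes define
    a homeomorphism. *)
Theorem pointed_lift (X Y : topologicalType) (eX : bits X) (eY : bits Y)
    (a : homeo X X) (b : homeo Y Y) M x0 x1 y0 y1 :
  minimal a -> minimal b -> corr a b M -> x0 <> x1 -> y0 <> y1 ->
  exists F : homeo X Y, [/\ K0_lift a b F, F x0 = y0 & F x1 = y1].
Proof.
move=> mina minb cM x01 y01.
pose I (s : (X -> nat) * (Y -> nat)) := pmatch M x0 x1 y0 y1 s.1 s.2.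
pose step k (s s' : (X -> nat) * (Y -> nat)) := exists (D : Y -> bool) (D' : X -> bool),
  (forall x, s'.1 x = ((s.1 x).*2 + eX k x)%N.*2 + D' x)%N /\
  (forall y, s'.2 y = ((s.2 y).*2 + D y)%N.*2 + eY k y)%N.
have I0 : I (fun=> 0%N, fun=> 0%N).
  split => //=; [exact: lc_cst|exact: lc_cst|move=> i].
  have [_|_] := eqVneq 0%N i; first exact: corr_ext (corr_one cM).
  exact: corr_ext (corr_zero cM).
have [|u [_ Hu]] := choice_seq I0 (step := step).
  move=> k [P Q] IPQ.
  have [D HD] := pmatch_refine eX eY mina minb cM y01 IPQ (bit_lc eX k).
  have [D' HD'] := pmatch_refine eY eX minb mina (corr_sym cM) x01 (pmatch_sym HD)
    (bit_lc eY k).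
  exists (fun x => (((P x).*2 + eX k x).*2 + D' x)%N,
          fun y => (((Q y).*2 + D y).*2 + eY k y)%N); last by exists D, D'.
  exact: pmatch_sym HD'.
pose P k := (u k).1; pose Q k := (u k).2.
have Pbit k x x' : P k.+1 x = P k.+1 x' -> P k x = P k x' /\ eX k x = eX k x'.
  have [_ [D [D' [HP _]]]] := Hu k; rewrite /P !HP => E.
  have := congr1 half E; rewrite !half_double_bit => E2.
  by have := congr1 odd E2; have := congr1 half E2; rewrite !half_double_bit !odd_double_bit.
have Qbit k y y' : Q k.+1 y = Q k.+1 y' -> eY k y = eY k y'.
  have [_ [D [D' [_ HQ]]]] := Hu k; rewrite /Q !HQ => E.
  by have := congr1 odd E; rewrite !odd_double_bit.
have MPQ k i : M (indic (fun x => P k x == i)) (indic (fun y => Q k y == i)).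
  by have [[_ _ H _ _] _] := Hu k.
have sepQ y y' : (forall k, Q k y = Q k y') -> y = y'.
  by move=> H; apply: (bits_sep (b := eY)) => k; exact: Qbit.
have [|||||||F HF] := @limit_homeo X Y eX eY P Q.
- by move=> k; have [[]] := Hu k.
- by move=> k; have [[]] := Hu k.
- by move=> x x' H; apply: (bits_sep (b := eX)) => k; have [] := Pbit k x x' (H _).
- exact: sepQ.
- move=> k x; have [|y /eqP Qy] := corr_nonempty eX mina cM (MPQ k (P k x)).
    by exists x.
  by exists y.
- move=> k y; have [|x /eqP Px] := corr_nonempty eY minb (corr_sym cM) (MPQ k (Q k y)).
    by exists y.
  by exists x.
- move=> k x y; have [_ [D [D' [HP HQ]]]] := Hu k; rewrite /P /Q HP HQ => E.
  have := congr1 half E; rewrite !half_double_bit => E2.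
  by have := congr1 half E2; rewrite !half_double_bit.
exists F; split.
- move=> f lf; apply: (corr_cob cM).
  have [k Hk] := lc_cell eX lf.
  have Pcell n x x' : P n x = P n x' -> cell eX n x = cell eX n x'.
    by elim: n x x' => [//|n IH] x x' /Pbit [/IH E1 E2] /=; rewrite E1 E2.
  have lP : lc (P k) by have [[]] := Hu k.
  have [N HN] := lc_bounded eX lP.
  have /choice [h Hh] : forall i, exists v, forall x, P k x = i -> f x = v.
    move=> i; have [[x Px]|nx] := pselect (exists x, P k x = i).
      by exists (f x) => x' Px'; apply/Hk/Pcell; rewrite Px.
    by exists 0 => x Px; case: nx; exists x.
  (* [f] is a combination of indicators of colours at one stage, and [M] respects such
     combinations. *)
  have H n : M (fun x => \sum_(0 <= i < n) h i * indic (fun x => P k x == i) x)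
      (fun y => \sum_(0 <= i < n) h i * indic (fun y => Q k y == i) y).
    elim: n => [|n IH].
      by apply: corr_ext (corr_zero cM) => x; rewrite big_geq.
    have := corr_add cM IH (corr_scale cM (h n) (MPQ k n)).
    by apply: corr_ext => x; rewrite big_nat_recr.
  have fE x : \sum_(0 <= i < N) h i * indic (fun x => P k x == i) x = f x.
    rewrite (bigD1_seq (P k x)) ?mem_index_iota ?iota_uniq ?HN//= /indic eqxx mulr1.
    rewrite big1 ?addr0 ?(Hh (P k x))// => i; rewrite eq_sym => /negbTE ->.
    by rewrite mulr0.
  apply: corr_ext (H N) => [//|y].
  rewrite /= -fE; apply: eq_bigr => i _; congr (_ * _); rewrite /indic.
  by rewrite -HF hinvK.
- by apply: sepQ => k; rewrite HF; have [[_ _ _ ? _] _] := Hu k.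
- by apply: sepQ => k; rewrite HF; have [[_ _ _ _ ?] _] := Hu k.
Qed.

(** * Strong orbit equivalence and approximate conjugacy *)

Section LiftHalf.
Variables (X Y : topologicalType) (a : homeo X X) (b : homeo Y Y) (F : homeo X Y).

(** The transport of a coboundary of [a] is the variation of a function under the conjugate of [a]
    by [F]; so this conjugate has only to act trivially on the [K^0] of [b]. *)
Lemma lift_half :
  (forall u : Y -> int, lc u -> cobound b (fun y => u (F (a (hinv F y))) - u y)) ->
  forall f, cobound a f -> cobound b (f \o hinv F).
Proof.
move=> H f [g lg fg].
have lu : lc (g \o hinv a \o hinv F).
  by apply: (lc_precomp (@hinv_cont _ _ F)); exact: (lc_precomp (@hinv_cont _ _ a)).
apply: cobound_ext (H _ lu) => y /=.
by rewrite fg !hfunK.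
Qed.

Lemma lift_of_halves :
  (forall f, cobound a f -> cobound b (f \o hinv F)) ->
  (forall g, cobound b g -> cobound a (g \o F)) -> K0_lift a b F.
Proof.
move=> H1 H2 f lf; split; first exact: H1.
by move=> /H2; apply: cobound_ext => x /=; rewrite hfunK.
Qed.

Lemma K0_lift_iso : K0_lift a b F -> K0_unital_order_iso a b.
Proof.
move=> HF; exists (fun f => f \o hinv F).
have lcF (f : X -> int) : lc f -> lc (f \o hinv F) by apply: lc_precomp; exact: hinv_cont.
have lcG (g : Y -> int) : lc g -> lc (g \o F) by apply: lc_precomp; exact: hfun_cont.
have sub (f g : X -> int) : lc f -> lc g -> lc (fun x => f x - g x).
  exact: (lc_comp2 (fun m n : int => m - n)).
split.
- by split => [f|f lf]; [exact: lcF|exact: HF].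
- move=> f g lf lg; apply: cobound_ext (cobound0 b) => y /=; lia.
- move=> g lg; exists (g \o F); first exact: lcG.
  by apply: cobound_ext (cobound0 b) => y /=; rewrite hinvK subrr.
- move=> f lf; split => -[p [lp p0 cp]].
    exists (p \o hinv F); split; [exact: lcF|by move=> y; exact: p0|].
    exact: ((HF _ (sub _ _ lf lp)).1 cp).
  exists (p \o F); split; [exact: lcG|by move=> y; exact: p0|].
  apply/HF; first by apply: sub => //; exact: lcG.
  by apply: cobound_ext cp => y /=; rewrite hinvK.
- by apply: cobound_ext (cobound0 b) => y /=; rewrite subrr.
Qed.

(** The conjugate [g] of [a] has a cocycle continuous off [y1]. Subtracting the constant [u (g y1)]
    makes the function vanish near [g y1], and the displacement may be set to 0 wherever the shifted
    function vanishes after [g]. *)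
Lemma soe_half (eY : bits Y) (n : X -> int) (x1 : X) :
  (forall x, F (a x) = iterz b (n x) (F x)) ->
  (forall x, x <> x1 -> int_cont_at n x) ->
  forall f, cobound a f -> cobound b (f \o hinv F).
Proof.
move=> Fn nc; apply: lift_half => u lu.
pose g : homeo Y Y := hcomp F (hcomp a (hsym F)).
pose y1 := F x1; pose w y := u y - u (g y1).
have lw : lc w by exact: (lc_comp (fun m => m - u (g y1)) lu).
have lwg : lc (w \o g) by exact: (lc_precomp (@hfun_cont _ _ g)).
pose nu y := if w (g y) == 0 then 0 else n (hinv F y).
have lnu : lc nu.
  move=> y; have [w0|w0] := eqVneq (w (g y)) 0.
    by have := lwg y; apply: filterS => z /= wz; rewrite /nu wz w0 eqxx.
  have yx1 : hinv F y <> x1.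
    by move=> E; case/eqP: w0; rewrite /w /y1 -E hinvK subrr.
  have cn : \forall z \near y, n (hinv F z) = n (hinv F y).
    exact: (@hinv_cont _ _ F y _ (nc _ yx1)).
  by have := lwg y; move: cn; apply: filterS2 => z nz /= wz; rewrite /nu wz nz.
apply: cobound_ext (cobound_transfer (g := g) eY lnu lw _) => [y|y wy].
  by rewrite /w /=; lia.
by rewrite /nu (negbTE wy) /= Fn hinvK.
Qed.

End LiftHalf.

Lemma soe_lift (X Y : topologicalType) (eX : bits X) (eY : bits Y) (a : homeo X X)
    (b : homeo Y Y) : strong_orbit_equiv a b -> exists F, K0_lift a b F.
Proof.
move=> [F [_ [n [m [Fn Fm [x1 nc] [y1 mc]]]]]]; exists F; apply: lift_of_halves.
  exact: (@soe_half _ _ a b F eY n x1 Fn nc).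
exact: (@soe_half _ _ b a (hsym F) eX m y1 Fm mc).
Qed.

Lemma orbit_map (X Y : topologicalType) (a : homeo X X) (b : homeo Y Y) (F : homeo X Y) :
  (forall x, exists k, F (a x) = iterz b k (F x)) ->
  forall k x, exists l, F (iterz a k x) = iterz b l (F x).
Proof.
move=> H k x; elim/int_ind: k => [|n [l IH]|n [l IH]]; first by exists 0.
  have [j Hj] := H (iterz a n x); exists (j + l).
  by rewrite -addn1 PoszD iterzS Hj IH iterzD.
have [j Hj] := H (iterz a (- n.+1%:Z) x); exists (- j + l).
rewrite iterzD -IH; have -> : - n%:Z = - n.+1%:Z + 1 by lia.
by rewrite iterzS Hj iterzK.
Qed.

Section Final.
Variables (X Y : topologicalType) (eX : bits X) (eY : bits Y).
Variables (a : homeo X X) (b : homeo Y Y) (x0 : X) (y0 : Y).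
Hypothesis mina : minimal a.
Hypothesis minb : minimal b.
Local Notation R := (Rseg eX x0 mina).
Local Notation S := (Rseg eY y0 minb).

Lemma fcr_lift : K0_unital_order_iso a b ->
  exists F : homeo X Y, [/\ F x0 = y0, F (hinv a x0) = hinv b y0,
    forall m, exists p, forall x y, F y \in S m (F x) -> y \in R p x &
    forall n, exists m, forall x y, y \in R n x -> F y \in S m (F x)].
Proof.
move=> /corr_of_iso [M cM].
have neX : x0 <> hinv a x0.
  by move=> /(congr1 a); rewrite hinvK; exact: (aperiodic (n := 1) eX mina).
have neY : y0 <> hinv b y0.
  by move=> /(congr1 b); rewrite hinvK; exact: (aperiodic (n := 1) eY minb).
have [F0 [HF F00 F01]] := pointed_lift eX eY mina minb cM neX neY.
have pB : preservesB R S F0.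
  move=> f lf; rewrite -(cobound_Bnull eX x0 mina lf).
  rewrite -(cobound_Bnull eY y0 minb); first exact: HF.
  by apply: lc_precomp lf; exact: hinv_cont.
apply: (intertwine eX eY _ _ _ _ pB F00 F01).
- by move=> n; exact: Rseg_mono.
- by move=> n; exact: Rseg_mono.
- by move=> n; exact: Rseg_cut.
- by move=> n; exact: Rseg_cut.
Qed.

(** Away from [hinv a x0], a point and its image locally share a segment of some [R p], so [F] sends
    them into one segment of some [S m], where displacement is a difference of positions. At
    [hinv a x0] the marked points give displacement 1. *)
Lemma cocycle_of_fcr (F : homeo X Y) : F x0 = y0 -> F (hinv a x0) = hinv b y0 ->
  (forall n, exists m, forall x y, y \in R n x -> F y \in S m (F x)) ->
  exists2 n : X -> int, (forall x, F (a x) = iterz b (n x) (F x)) &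
    forall x, x <> hinv a x0 -> int_cont_at n x.
Proof.
move=> F0 F1 RS.
have loc x : x <> hinv a x0 -> exists m, \forall z \near x, F (a z) \in S m (F z).
  move=> xx1; have [|p Hp] := @Rseg_next _ eX a x0 mina x.
    by move=> E; apply: xx1; rewrite -E hfunK.
  have [m Hm] := RS p; exists m; apply: filterS Hp => z; exact: Hm.
have /choice [n Hn] : forall x, exists k, F (a x) = iterz b k (F x).
  move=> x; have [->|/loc [m Hm]] := pselect (x = hinv a x0).
    by exists 1; rewrite hinvK F0 F1 /= hinvK.
  by have /seg_disp E := nbhs_singleton Hm; eexists; exact: E.
exists n => // x /loc [m Hm].
pose btm := bt eY minb (Ecell_lc eY y0 m) (Ecell_ne eY y0 m).
have lb : lc btm by exact: bt_lc.
have l1 := lc_precomp (@hfun_cont _ _ F) lb.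
have l2 := lc_precomp (@hfun_cont _ _ a) l1.
have nE z : F (a z) \in S m (F z) -> n z = (btm (F (a z)))%:Z - (btm (F z))%:Z.
  move=> /seg_disp E; apply: (iterz_inj eY minb (x := F z)).
  by rewrite -Hn {1}E.
have := lc_comp2 (fun i j : nat => i%:Z - j%:Z) l2 l1 x.
by move: Hm (nbhs_singleton Hm) => Hm Hx; move: Hm; apply: filterS2 => z Hz /= E; rewrite !nE.
Qed.

(* [s] rearranges each long [a]-segment in the order of [key]: the [b]-segments
   contained in it one after the other, each in its own order. *)
Lemma conj_approx (F : homeo X Y) (m : nat) :
  (exists p, forall x y, F y \in S m (F x) -> y \in R p x) ->
  exists2 s : homeo X X, top_full_group a s &
    forall y, cell eY m (F (s (a (hinv s (hinv F y))))) = cell eY m (b y).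
Proof.
move=> [p Hp].
pose btX := bt eX mina (Ecell_lc eX x0 p) (Ecell_ne eX x0 p).
pose baseX := base eX mina (Ecell_lc eX x0 p) (Ecell_ne eX x0 p).
pose rtX := rt eX mina (Ecell_lc eX x0 p) (Ecell_ne eX x0 p).
pose btY := bt eY minb (Ecell_lc eY y0 m) (Ecell_ne eY y0 m).
pose baseY := base eY minb (Ecell_lc eY y0 m) (Ecell_ne eY y0 m).
have lbX : lc btX by exact: bt_lc.
have lbY : lc btY by exact: bt_lc.
have [T [TE Tsz Ttfg]] : exists T : fcr X,
    [/\ forall x y, (y \in T x) = (baseX y == baseX x),
        forall x, size (T x) = rtX (baseX x) &
        forall s : homeo X X, (forall x, s x \in T x) -> top_full_group a s].
  exists (R p); split; first by move=> x y; exact: mem_seg.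
    by move=> x; rewrite /= /seg_cls size_map size_iota.
  by move=> s; exact: seg_tfg.
have ST x y : baseY (F y) = baseY (F x) -> y \in T x.
  by move=> E; rewrite TE -mem_seg; apply: Hp; rewrite mem_seg; apply/eqP.
have btX_inj x y : y \in T x -> btX y = btX x -> y = x.
  rewrite TE => /eqP E1 E2.
  have iX z : iter (btX z) a (baseX z) = z by exact: iter_base.
  by rewrite -[LHS]iX -[RHS]iX E1 E2.
have btX_lt x y : y \in T x -> (btX y < size (T x))%N.
  by rewrite TE Tsz => /eqP <-; exact: bt_lt_rt.
have [N HN] := lc_bounded eY lbY.
pose rep y := hinv F (baseY (F y)).
have rep_cont : continuous rep.
  apply: continuous_compose (@hinv_cont _ _ F); apply: continuous_compose.
    exact: hfun_cont.
  exact: base_cont.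
have baseY_id y : baseY (baseY y) = baseY y by apply: base_id; exact: E_base.
have rep_T y : rep y \in T y by apply: ST; rewrite /rep hinvK baseY_id.
(* Lexicographic code: the position in the [a]-segment of the start of the [b]-segment, then the
   position inside the [b]-segment, which is below [N]. *)
pose key y := (btX (rep y) * N + btY (F y))%N.
have key_lc : lc key.
  apply: (lc_comp2 (fun i j => (i * N + j)%N)).
    exact: (lc_precomp rep_cont lbX).
  exact: (lc_precomp (@hfun_cont _ _ F) lbY).
have key_inj x y : y \in T x -> key y = key x -> y = x.
  move=> yx E; have N0 : (0 < N)%N by exact: leq_ltn_trans (HN (F x)).
  have := congr1 (fun k => k %/ N)%N E; have := congr1 (fun k => k %% N)%N E.
  rewrite /= /key !modnMDl !divnMDl// !modn_small// !divn_small// !addn0 => E1 E2.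
  have repE : rep y = rep x.
    apply: btX_inj E2; rewrite (cls_eq (rep_T x)); apply: cls_trans yx _.
    exact: rep_T.
  have bE : baseY (F y) = baseY (F x) by rewrite -(hinvK F (baseY (F y))) -/(rep y) repE hinvK.
  apply: (can_inj (hfunK F)).
  have iY z : iter (btY z) b (baseY z) = z by exact: iter_base.
  by rewrite -[LHS]iY -[RHS]iY bE E1.
pose r y := count (fun k => k < key y)%N (map key (T y)).
have r_lc : lc r.
  exact: (lc_comp2 (fun k l => count (fun k' => k' < k)%N l) key_lc (lc_cls_map T key_lc)).
have key_uniq x : uniq (map key (T x)).
  rewrite map_inj_in_uniq ?cls_uniq// => y z yx zx E.
  by apply: key_inj E; rewrite (cls_eq zx).
have count_succ (l : seq nat) k :
    count (fun k' => k' < k.+1)%N l = (count (fun k' => k' < k)%N l + count_mem k l)%N.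
  by elim: l => [//|i l /= ->]; case: (ltngtP i k) => ik /=; lia.
have rS x y : y \in T x -> key y = (key x).+1 -> r y = (r x).+1.
  move=> yx E; rewrite /r (cls_eq yx) E count_succ count_uniq_mem ?key_uniq//.
  by rewrite map_f ?cls_self// addn1.
have r_mono x y : y \in T x -> (key x < key y)%N -> (r x < r y)%N.
  move=> yx xy; rewrite {2}/r (cls_eq yx).
  apply: (@leq_trans (count (fun k => k < (key x).+1)%N (map key (T x)))).
    by rewrite count_succ count_uniq_mem ?key_uniq// map_f ?cls_self// addn1.
  by apply: sub_count => k /= kx; exact: leq_trans kx xy.
have r_inj x y : y \in T x -> r y = r x -> y = x.
  move=> yx E; apply: key_inj => //; case: (ltngtP (key y) (key x)) => // H.
    by have := r_mono y x (cls_sym yx) H; rewrite E ltnn.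
  by have := r_mono x y yx H; rewrite E ltnn.
have r_lt x y : y \in T x -> (r y < size (T x))%N.
  move=> yx; rewrite /r (cls_eq yx) -(size_map key) ltn_neqAle count_size andbT.
  rewrite -all_count; apply/allPn; exists (key y); first by rewrite map_f.
  by rewrite ltnn.
(* Positions and ranks both enumerate the numbers below the class size, so [s] can send the point at
   position [i] to the point of rank [i]. *)
have [||i|s Hs] := @fcr_match X eX T btX r.
- exact: lbX.
- exact: r_lc.
- move=> x; rewrite /csum sumrB !sum_indic; apply/eqP; rewrite subr_eq0; apply/eqP.
  have perm (f : X -> nat) : (forall y z, y \in T x -> z \in T x -> f y = f z -> y = z) ->
      (forall y, y \in T x -> (f y < size (T x))%N) ->
      perm_eq (map f (T x)) (iota 0 (size (T x))).
    move=> finj flt; have uf : uniq (map f (T x)) by rewrite map_inj_in_uniq// cls_uniq.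
    have [||_ E] := @uniq_min_size _ (map f (T x)) (iota 0 (size (T x))) uf.
    + by move=> k /mapP [y yx ->]; rewrite mem_iota /= flt.
    + by rewrite size_map size_iota.
    + by apply: uniq_perm => //; exact: iota_uniq.
  have p1 : perm_eq (map btX (T x)) (iota 0 (size (T x))).
    apply: perm => [y z yx zx|y yx]; last exact: btX_lt.
    by apply: btX_inj; rewrite (cls_eq zx).
  have p2 : perm_eq (map r (T x)) (iota 0 (size (T x))).
    apply: perm => [y z yx zx|y yx]; last exact: r_lt.
    by apply: r_inj; rewrite (cls_eq zx).
  have /permP /(_ (pred1 i)) : perm_eq (map btX (T x)) (map r (T x)).
    by rewrite (perm_trans p1)// perm_sym.
  by rewrite !count_map => ->.
have sT x : s x \in T x by have [] := Hs x.
have sr x : r (s x) = btX x by have [] := Hs x.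
(* Inside a [b]-segment keys are consecutive, hence so are ranks, and [s] turns the step of [a] into
   the step of [b]. *)
have stepE z : ~~ Ecell eY y0 m (b (F z)) -> F (s (a (hinv s z))) = b (F z).
  move=> nE; set w := hinv F (b (F z)); have Fw : F w = b (F z) by exact: hinvK.
  have [bt1 base1] : btY (F w) = (btY (F z)).+1 /\ baseY (F w) = baseY (F z).
    by rewrite Fw; apply: bt_next.
  have wz : w \in T z by exact: ST.
  have rw : r w = (r z).+1.
    by apply: rS => //; rewrite /key /rep base1 bt1 addnS.
  set v := hinv s z; have sv : s v = z by exact: hinvK.
  have vz : v \in T z by apply: cls_sym; rewrite -sv sT.
  have btv : btX v = r z by rewrite -sr sv.
  have nEv : ~~ Ecell eX x0 p (a v).
    apply/negP => Eav; have H : rtX (baseX v) = (btX v).+1 by exact: rt_last.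
    have := r_lt z w wz; rewrite rw Tsz.
    have : baseX v = baseX z by apply/eqP; rewrite -TE.
    by move=> <-; rewrite H btv ltnn.
  have [bt2 base2] : btX (a v) = (btX v).+1 /\ baseX (a v) = baseX v by apply: bt_next.
  have avz : a v \in T z by rewrite TE base2 -TE.
  rewrite -Fw; congr (F _); apply: r_inj; last by rewrite sr bt2 btv rw.
  by rewrite (cls_eq wz) -(cls_eq avz).
exists s; first exact: Ttfg.
move=> y; set z := hinv F y; have Fz : F z = y by exact: hinvK.
have [Eby|nE] := boolP (Ecell eY y0 m (b y)); last by rewrite stepE Fz.
(* At the end of a [b]-segment the two images may differ, but both lie in the cell of [y0]:
   otherwise [stepE] at the [b]-preimage of [F x'] would force [b y] to be [F x']. *)
set x' := s (a (hinv s z)).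
suff Ex' : Ecell eY y0 m (F x') by rewrite (eqP Ex') (eqP Eby).
apply/negPn/negP => nE.
have := stepE (hinv F (hinv b (F x'))); rewrite !hinvK => /(_ nE).
move=> /(can_inj (hfunK F))/(can_inj (hfunK s))/(can_inj (hfunK a))/(can_inj (hinvK s)).
move=> E; move: nE; rewrite -{1}(hinvK b (F x')).
have -> : hinv b (F x') = y by rewrite -Fz -E hinvK.
by rewrite Eby.
Qed.

End Final.

Lemma iso_soe (X Y : topologicalType) (eX : bits X) (eY : bits Y)
    (a : homeo X X) (b : homeo Y Y) (x0 : X) (y0 : Y) :
  minimal a -> minimal b -> K0_unital_order_iso a b -> strong_orbit_equiv a b.
Proof.
move=> mina minb /(fcr_lift eX eY x0 y0 mina minb) [F [F0 F1 SR RS]].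
have G0 : hinv F y0 = x0 by rewrite -F0 hfunK.
have G1 : hinv F (hinv b y0) = hinv a x0 by rewrite -F1 hfunK.
have [n Fn nc] := cocycle_of_fcr F0 F1 RS.
have [|m Fm mc] := @cocycle_of_fcr Y X eY eX b a y0 x0 minb mina (hsym F) G0 G1.
  by move=> k; have [p Hp] := SR k; exists p => x y yx; apply: Hp; rewrite /= !hinvK.
exists F; split; last by exists n, m; split => //; [exists (hinv a x0)|exists (hinv b y0)].
move=> x x'; split => -[k Hk].
  by rewrite Hk; apply: orbit_map => z; exists (n z).
have [|l] := @orbit_map _ _ b a (hsym F) _ k (F x); first by move=> z; exists (m z).
by rewrite -Hk /= !hfunK; exists l.
Qed.

(** * The closure and approximation conditions *)

Section Conditions.
Variables (R : realType) (X Y : pseudoMetricType R) (eX : bits X) (eY : bits Y).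
Variables (a : homeo X X) (b : homeo Y Y).
Hypothesis mina : minimal a.
Hypothesis minb : minimal b.

Lemma iso_approx (x0 : X) (y0 : Y) : K0_unital_order_iso a b ->
  exists (F : homeo X Y) (s : nat -> homeo X X) (t : nat -> homeo Y Y),
    [/\ forall n, top_full_group a (s n), forall n, top_full_group b (t n),
        unif_cvg (fun n y => F (s n (a (hinv (s n) (hinv F y))))) b &
        unif_cvg (fun n x => hinv F (t n (b (hinv (t n) (F x))))) a].
Proof.
move=> /(fcr_lift eX eY x0 y0 mina minb) [F [F0 F1 SR RS]].
have /choice [s Hs] : forall m, exists s : homeo X X, top_full_group a s /\
    forall y, cell eY m (F (s (a (hinv s (hinv F y))))) = cell eY m (b y).
  by move=> m; have [s ? ?] := conj_approx (SR m); exists s.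
have /choice [t Ht] : forall m, exists t : homeo Y Y, top_full_group b t /\
    forall x, cell eX m (hinv F (t (b (hinv t (F x))))) = cell eX m (a x).
  move=> m; have [|t ? ?] := @conj_approx _ _ eY eX b a y0 x0 minb mina (hsym F) m.
    by have [p Hp] := RS m; exists p => x y /Hp; rewrite /= !hinvK.
  by exists t.
exists F, s, t; split; [by move=> n; have [] := Hs n|by move=> n; have [] := Ht n| |].
  move=> r /(cell_ball eY) [k Hk]; exists k => n kn y; apply: Hk.
  by apply: (cellW kn); have [_ ->] := Hs n.
move=> r /(cell_ball eX) [k Hk]; exists k => n kn y; apply: Hk.
by apply: (cellW kn); have [_ ->] := Ht n.
Qed.

Lemma lift_closure (F : homeo X Y) : K0_lift a b F -> forall g : homeo X X,
  in_closure_tfg a g <->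
  exists2 t : homeo Y Y, in_closure_tfg b t & forall x, g x = hinv F (t (F x)).
Proof.
move=> HF g; split => [/(closure_tfgP eX mina) cg|[t /(closure_tfgP eY minb) ct gt]].
  exists (hcomp F (hcomp g (hsym F))); last by move=> x /=; rewrite !hfunK.
  apply/(closure_tfgP eY minb) => f lf.
  have lF : lc (f \o F) by exact: (lc_precomp (@hfun_cont _ _ F)).
  have c := cg _ lF; have := (HF _ (cobound_lc c)).1 c.
  by apply: cobound_ext => y /=; rewrite hinvK.
apply/(closure_tfgP eX mina) => f lf.
have lF : lc (f \o hinv F) by exact: (lc_precomp (@hinv_cont _ _ F)).
have c := ct _ lF; have := ((K0_lift_sym HF) _ (cobound_lc c)).1 c.
by apply: cobound_ext => x /=; rewrite -gt hfunK.
Qed.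

(** Applied to [a] and to the conjugate of [b], the hypothesis says that each map, transported by
    [F], acts trivially on the other [K^0]. *)
Lemma closure_lift (F : homeo X Y) : (forall g : homeo X X,
    in_closure_tfg a g <->
    exists2 t : homeo Y Y, in_closure_tfg b t & forall x, g x = hinv F (t (F x))) ->
  K0_lift a b F.
Proof.
move=> HF.
have self (Z : pseudoMetricType R) (c : homeo Z Z) : in_closure_tfg c c.
  move=> r r0; exists c; last by move=> z; exact: ballxx.
  by exists (fun=> 1); first exact: lc_cst.
apply: lift_of_halves.
  have [t ct at_] := (HF a).1 (self _ a); apply: lift_half => u lu.
  have := (closure_tfgP eY minb t).1 ct u lu; apply: cobound_ext => y.
  by rewrite at_ !hinvK.
apply: (@lift_half _ _ b a (hsym F)) => u lu.
have : in_closure_tfg a (hcomp (hsym F) (hcomp b F)).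
  by apply/HF; exists b => //; exact: self.
by move=> /(closure_tfgP eX mina) /(_ u lu).
Qed.

(** For [n] large the conjugate of [a] by [s n] moves a given locally constant function exactly as
    the transported [b] does, and it acts trivially on [K^0] because [s n] and [a] do. *)
Lemma approx_lift (F : homeo X Y) (s : nat -> homeo X X) (t : nat -> homeo Y Y) :
  (forall n, top_full_group a (s n)) -> (forall n, top_full_group b (t n)) ->
  unif_cvg (fun n y => F (s n (a (hinv (s n) (hinv F y))))) b ->
  unif_cvg (fun n x => hinv F (t n (b (hinv (t n) (F x))))) a ->
  K0_lift a b F.
Proof.
have half (X' Y' : pseudoMetricType R) (e : bits X') (e' : bits Y') (a0 : homeo X' X')
    (b0 : homeo Y' Y') (G : homeo X' Y') (s' : nat -> homeo X' X') :
    (forall n, top_full_group a0 (s' n)) ->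
    unif_cvg (fun n y => G (s' n (a0 (hinv (s' n) (hinv G y))))) b0 ->
    forall g, cobound b0 g -> cobound a0 (g \o G).
  move=> ts cv; apply: (@lift_half _ _ b0 a0 (hsym G)) => u lu.
  have lG : lc (u \o hinv G) by exact: (lc_precomp (@hinv_cont _ _ G)).
  have [k Hk] := lc_cell e' lG; have [r r0 Hr] := ball_cell e' k.
  have [N HN] := cv r r0; pose sN := s' N.
  have uE x : u (hinv G (b0 (G x))) = u (sN (a0 (hinv sN x))).
    have := Hk _ _ (Hr _ _ (HN N (leqnn N) (G x))).
    by rewrite /= !hfunK.
  have lus : lc (u \o sN) by exact: (lc_precomp (@hfun_cont _ _ sN)).
  have c1 : cobound a0 (fun z => u (sN (a0 z)) - u (sN z)).
    exact: (cobound_iterz a0 1 lus).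
  have lc2 : lc (fun x => u (sN (a0 (hinv sN x))) - u x).
    have := lc_precomp (@hinv_cont _ _ sN) (cobound_lc c1).
    by congr lc; apply: funext => x /=; rewrite hinvK.
  have tN : top_full_group a0 sN := ts N.
  have := coboundB c1 (cobound_tfg e tN lc2).
  apply: cobound_ext => x /=; rewrite hfunK uE; lia.
move=> ts tt cs ct; apply: lift_of_halves; last exact: half eX eY _ _ _ _ ts cs.
exact: (half _ _ eY eX b a (hsym F) t tt ct).
Qed.

End Conditions.

Theorem theorem3p4 (R : realType) (X Y : pseudoMetricType R)
    (a : homeo X X) (b : homeo Y Y) :
  cantor_set X -> cantor_set Y -> minimal a -> minimal b ->
  [<-> K0_unital_order_iso a b;
       strong_orbit_equiv a b;
       exists F : homeo X Y, forall g : homeo X X,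
         in_closure_tfg a g <->
         exists2 t : homeo Y Y, in_closure_tfg b t &
           forall x, g x = hinv F (t (F x));
       exists (F : homeo X Y) (s : nat -> homeo X X) (t : nat -> homeo Y Y),
         [/\ forall n, top_full_group a (s n),
             forall n, top_full_group b (t n),
             unif_cvg (fun n y => F (s n (a (hinv (s n) (hinv F y))))) b &
             unif_cvg (fun n x => hinv F (t n (b (hinv (t n) (F x))))) a]].
Proof.
move=> CX CY mina minb.
have [eX _] := cantor_bits CX; have [eY _] := cantor_bits CY.
have [[_ [x0 _]] [_ [y0 _]]] := (CX, CY).
tfae.
- exact: (iso_soe eX eY x0 y0 mina minb).
- by move=> /(soe_lift eX eY) [F HF]; exists F; exact: lift_closure.
- move=> [F /(closure_lift eX eY mina minb) HF].
  exact: (iso_approx eX eY mina minb x0 y0 (K0_lift_iso HF)).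
- move=> [F [s [t [ts tt cs ct]]]].
  exact: (K0_lift_iso (approx_lift eX eY ts tt cs ct)).
Qed.
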